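(* Let $f:\mathcal{C}^d\to\mathcal{S}$ be a (scalar) noncommutative function on the set $\mathcal{C}^d$ of Schur spectral contractions in $d$ variables which is positivity preserving. Then there are complex coefficients $c_\alpha$, indexed by words $\alpha$ in the letters $1,\dots,d$ (including the empty word), with $c_\alpha\ge 0$ for every $\alpha$, such that for every generalized Schur product $*$ and every $X\in\mathcal{C}^d\cap\mathcal{S}_*^d$ the series $\sum_\alpha c_\alpha X^\alpha$ converges and equals $f(X)$. Here $X^\alpha=X_{\alpha_1}*X_{\alpha_2}*\cdots*X_{\alpha_k}$ for $\alpha=\alpha_1\cdots\alpha_k$, and $X^{\emptyset}$ is the identity element of $*$.
   Context: Generalized Schur product: given unital associative algebras $\mathcal{A}$ (dim $n$), $\mathcal{B}$ (dim $m$) and linear bijections $v_{\mathcal{A}}:\mathcal{A}\to\mathbb{C}^n$, $v_{\mathcal{B}}:\mathcal{B}\to\mathbb{C}^m$, it is the unique bilinear product $*$ on $n\times m$ complex matrices with $v_{\mathcal{A}}(a)v_{\mathcal{B}}(b)^* * v_{\mathcal{A}}(c)v_{\mathcal{B}}(d)^* = v_{\mathcal{A}}(ac)v_{\mathcal{B}}(bd)^*$. $\mathcal{S}_*$ denotes $n\times m$ matrices with product $*$; $\mathcal{S}^d=\bigsqcup_*\mathcal{S}_*^d$ (disjoint union over all generalized Schur products), $\mathcal{S}=\mathcal{S}^1$. A generalized Schur product is positivity preserving if $n=m$ and the $*$-product of two positive semidefinite matrices is positive semidefinite. Schur spectral contraction: $X=(X_1,\dots,X_d)\in\mathcal{S}_*^d$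 ($n\times m$ matrices) is one if there exist tuples $A=(A_i)$ of $m\times m$ and $B=(B_i)$ of $n\times n$ matrices such that each $Y_i=\begin{pmatrix}A_i & X_i^*\\ X_i & B_i\end{pmatrix}$ is positive definite and the tuple $(Y_1,\dots,Y_d)$ has joint spectral radius $<1$, where the $(m+n)\times(m+n)$ matrices carry the generalized Schur product built from the direct sum algebras on both sides (so that the $X$-blocks multiply via $*$), and the joint spectral radius of $(Y_i)$ in a finite-dimensional algebra is $\lim_{k}\max_{|w|=k}\|Y_w\|^{1/k}$ with $Y_w$ the product of the $Y_{i}$ along the word $w$. $\mathcal{C}^d$ is the set of all Schur spectral contractions (over all $*$). Scalar noncommutative function $f:\mathcal{U}\to\mathcal{S}$ ($\mathcal{U}\subseteq\mathcal{S}^d$): (1) $f(X)$ lies in the algebra (in $\mathcal{S}_*$) generated by $X_1,\dots,X_d$; (2) whenever $\varphi$ is a homomorphism from the algebra generated by $X\in\mathcal{U}$ to the algebra generated by $Y\in\mathcal{U}$ with $\varphi(X_i)=Y_i$, then $f(Y)=\varphi(f(X))$. $f$ is positivity preserving if whenever $X\in\mathcal{S}_*^d\cap\mathcal{U}$ with $*$ positivity preserving and each $X_i\ge0$, then $f(X)\ge 0$. *)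

(* Defs.v *)
From Stdlib Require Import Reals List.
Open Scope R_scope.

Definition Cplx := (R * R)%type.
Definition Cre (z : Cplx) : R := fst z.
Definition Cim (z : Cplx) : R := snd z.
Definition C0 : Cplx := (0, 0).
Definition C1 : Cplx := (1, 0).
Definition Cadd (a b : Cplx) : Cplx := (fst a + fst b, snd a + snd b).
Definition Csub (a b : Cplx) : Cplx := (fst a - fst b, snd a - snd b).
Definition Cmul (a b : Cplx) : Cplx :=
  (fst a * fst b - snd a * snd b, fst a * snd b + snd a * fst b).
Definition Cconj (a : Cplx) : Cplx := (fst a, - snd a).
Definition Cabs (a : Cplx) : R := sqrt (fst a * fst a + snd a * snd a).

Fixpoint Csum (n : nat) (f : nat -> Cplx) : Cplx :=
  match n with O => C0 | S k => Cadd (Csum k f) (f k) end.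
Fixpoint Rsum (n : nat) (f : nat -> R) : R :=
  match n with O => 0 | S k => Rsum k f + f k end.

Definition Ccv (u : nat -> Cplx) (l : Cplx) : Prop :=
  Un_cv (fun k => Cre (u k)) (Cre l) /\ Un_cv (fun k => Cim (u k)) (Cim l).

(* A matrix is given by its entries; for an n x m matrix only the entries
   (i,j) with i < n, j < m are meaningful.  Equality of n x m matrices is
   [meq n m]. *)
Definition Mat := nat -> nat -> Cplx.
Definition meq (n m : nat) (X Y : Mat) : Prop :=
  forall i j, (i < n)%nat -> (j < m)%nat -> X i j = Y i j.
Definition mzero : Mat := fun _ _ => C0.
Definition madd (X Y : Mat) : Mat := fun i j => Cadd (X i j) (Y i j).
Definition mscale (c : Cplx) (X : Mat) : Mat := fun i j => Cmul c (X i j).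

Definition qform (N : nat) (Y : Mat) (x : nat -> Cplx) : Cplx :=
  Csum N (fun i => Csum N (fun j => Cmul (Cconj (x i)) (Cmul (Y i j) (x j)))).
Definition psd (N : nat) (Y : Mat) : Prop :=
  forall x : nat -> Cplx, Cim (qform N Y x) = 0 /\ 0 <= Cre (qform N Y x).
Definition pd (N : nat) (Y : Mat) : Prop :=
  forall x : nat -> Cplx, (exists i, (i < N)%nat /\ x i <> C0) ->
    Cim (qform N Y x) = 0 /\ 0 < Cre (qform N Y x).

(* An n-dimensional algebra A together with a linear bijection
   v_A : A -> Cplx^n is the same as an algebra structure on Cplx^n, given by
   structure constants  e_i e_j = sum_k mul i j k e_k  and a unit vector. *)
Definition vmul (n : nat) (mul : nat -> nat -> nat -> Cplx) (x y : nat -> Cplx)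
  : nat -> Cplx :=
  fun k => Csum n (fun i => Csum n (fun j => Cmul (Cmul (x i) (y j)) (mul i j k))).
Definition veq (n : nat) (x y : nat -> Cplx) : Prop :=
  forall k, (k < n)%nat -> x k = y k.
Definition is_ualg (n : nat) (mul : nat -> nat -> nat -> Cplx) (u : nat -> Cplx)
  : Prop :=
  (forall x y z, veq n (vmul n mul (vmul n mul x y) z)
                       (vmul n mul x (vmul n mul y z))) /\
  (forall x, veq n (vmul n mul u x) x) /\
  (forall x, veq n (vmul n mul x u) x).

(* A generalized Schur product on n x m matrices: data of algebras on Cplx^n
   (structure constants ga, unit gua) and on Cplx^m (gb, gub). *)
Record GSP := mkGSP {
  gn : nat; gm : nat;
  ga : nat -> nat -> nat -> Cplx; gua : nat -> Cplx;
  gb : nat -> nat -> nat -> Cplx; gub : nat -> Cplx }.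
Definition is_gsp (s : GSP) : Prop :=
  is_ualg (gn s) (ga s) (gua s) /\ is_ualg (gm s) (gb s) (gub s).

(* The unique bilinear product with
   v_A(a) v_B(b)^* * v_A(c) v_B(d)^* = v_A(ac) v_B(bd)^*  ;
   on matrix units: E_ij * E_kl = v_A(e_i e_k) v_B(e_j e_l)^*. *)
Definition sprod (s : GSP) (X Y : Mat) : Mat :=
  fun p q =>
    Csum (gn s) (fun i => Csum (gm s) (fun j => Csum (gn s) (fun k =>
    Csum (gm s) (fun l =>
      Cmul (Cmul (X i j) (Y k l)) (Cmul (ga s i k p) (Cconj (gb s j l q))))))).
Definition sident (s : GSP) : Mat :=
  fun p q => Cmul (gua s p) (Cconj (gub s q)).

(* words are lists of letters 0..d-1 (letter i stands for the paper's i+1) *)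
Definition is_word (d : nat) (w : list nat) : Prop := Forall (fun i => (i < d)%nat) w.
Fixpoint wprod (s : GSP) (X : nat -> Mat) (w : list nat) : Mat :=
  match w with
  | nil => sident s
  | i :: w' => sprod s (X i) (wprod s X w')
  end.
Fixpoint words (d k : nat) : list (list nat) :=
  match k with
  | O => nil :: nil
  | S k' => flat_map (fun w => map (fun i => i :: w) (seq 0 d)) (words d k')
  end.

Definition pos_pres (s : GSP) : Prop :=
  gn s = gm s /\
  forall P Q, psd (gn s) P -> psd (gn s) Q -> psd (gn s) (sprod s P Q).

Definition dsum_mul (m : nat) (b a : nat -> nat -> nat -> Cplx) : nat -> nat -> nat -> Cplx :=
  fun i j k =>
    if Nat.ltb i m then
      (if Nat.ltb j m then (if Nat.ltb k m then b i j k else C0) else C0)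
    else
      (if Nat.ltb j m then C0 else (if Nat.ltb k m then C0 else a (i - m)%nat (j - m)%nat (k - m)%nat)).
Definition dsum_unit (m : nat) (ub ua : nat -> Cplx) : nat -> Cplx :=
  fun k => if Nat.ltb k m then ub k else ua (k - m)%nat.
(* generalized Schur product on (m+n) x (m+n) matrices built from the
   direct sum algebra B (+) A on both sides; its lower-left n x m block
   multiplies via the product of s. *)
Definition block_gsp (s : GSP) : GSP :=
  mkGSP (gm s + gn s) (gm s + gn s)
        (dsum_mul (gm s) (gb s) (ga s)) (dsum_unit (gm s) (gub s) (gua s))
        (dsum_mul (gm s) (gb s) (ga s)) (dsum_unit (gm s) (gub s) (gua s)).
(* the block matrix [[A, X^*],[X, B]] with A m x m, X n x m, B n x n *)
Definition blockY (m : nat) (A X B : Mat) : Mat :=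
  fun i j =>
    if Nat.ltb i m then
      (if Nat.ltb j m then A i j else Cconj (X (j - m)%nat i))
    else
      (if Nat.ltb j m then X (i - m)%nat j else B (i - m)%nat (j - m)%nat).

Definition mnorm (N : nat) (Y : Mat) : R :=
  sqrt (Rsum N (fun i => Rsum N (fun j => Cabs (Y i j) * Cabs (Y i j)))).
Definition rootk (k : nat) (x : R) : R :=
  if Rle_dec x 0 then 0 else Rpower x (/ INR k).
Definition maxnorm (s : GSP) (d : nat) (Y : nat -> Mat) (k : nat) : R :=
  fold_right (fun w acc => Rmax (mnorm (gn s) (wprod s Y w)) acc) 0 (words d k).
(* joint spectral radius of (Y_0..Y_{d-1}) in the algebra S_s (square) is < 1:
   lim_k max_{|w|=k} ||Y_w||^{1/k} exists and is < 1 *)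
Definition jsr_lt1 (s : GSP) (d : nat) (Y : nat -> Mat) : Prop :=
  exists L, L < 1 /\
    Un_cv (fun k => rootk (S k) (maxnorm s d Y (S k))) L.

Definition schur_spec_contr (d : nat) (s : GSP) (X : nat -> Mat) : Prop :=
  exists A B : nat -> Mat,
    (forall i, (i < d)%nat -> pd (gm s + gn s) (blockY (gm s) (A i) (X i) (B i))) /\
    jsr_lt1 (block_gsp s) d (fun i => blockY (gm s) (A i) (X i) (B i)).

Definition inCd (d : nat) (s : GSP) (X : nat -> Mat) : Prop :=
  is_gsp s /\ schur_spec_contr d s X.

Definition lincomb (s : GSP) (X : nat -> Mat) (l : list (list nat * Cplx)) : Mat :=
  fold_right (fun wc acc => madd (mscale (snd wc) (wprod s X (fst wc))) acc) mzero l.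
Definition in_gen (d : nat) (s : GSP) (X : nat -> Mat) (Z : Mat) : Prop :=
  exists l : list (list nat * Cplx),
    (forall wc, In wc l -> is_word d (fst wc)) /\
    meq (gn s) (gm s) Z (lincomb s X l).

Definition is_hom (d : nat) (s : GSP) (X : nat -> Mat) (t : GSP) (Y : nat -> Mat)
  (phi : Mat -> Mat) : Prop :=
  (forall Z Z', in_gen d s X Z -> meq (gn s) (gm s) Z Z' ->
     meq (gn t) (gm t) (phi Z) (phi Z')) /\
  (forall Z W, in_gen d s X Z -> in_gen d s X W ->
     meq (gn t) (gm t) (phi (madd Z W)) (madd (phi Z) (phi W))) /\
  (forall c Z, in_gen d s X Z ->
     meq (gn t) (gm t) (phi (mscale c Z)) (mscale c (phi Z))) /\
  (forall Z W, in_gen d s X Z -> in_gen d s X W ->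
     meq (gn t) (gm t) (phi (sprod s Z W)) (sprod t (phi Z) (phi W))) /\
  meq (gn t) (gm t) (phi (sident s)) (sident t) /\
  (forall i, (i < d)%nat -> meq (gn t) (gm t) (phi (X i)) (Y i)).

Definition nc_function (d : nat) (f : GSP -> (nat -> Mat) -> Mat) : Prop :=
  (forall s X, inCd d s X -> in_gen d s X (f s X)) /\
  (forall s X t Y phi, inCd d s X -> inCd d t Y -> is_hom d s X t Y phi ->
     meq (gn t) (gm t) (f t Y) (phi (f s X))).

Definition nc_pos_pres (d : nat) (f : GSP -> (nat -> Mat) -> Mat) : Prop :=
  forall s X, inCd d s X -> pos_pres s ->
    (forall i, (i < d)%nat -> psd (gn s) (X i)) -> psd (gn s) (f s X).

Definition psum (d : nat) (c : list nat -> Cplx) (s : GSP) (X : nat -> Mat) (K : nat) : Mat :=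
  fun p q =>
    Csum (S K) (fun k =>
      fold_right (fun w acc => Cadd (Cmul (c w) (wprod s X w p q)) acc) C0 (words d k)).

(* Main.v *)
Require Import Defs.
From Stdlib Require Import Reals List Lra Lia.
From mathcomp Require all_boot all_order all_algebra spectral complex Rstruct ring lra zify.
Open Scope R_scope.

(** Since [f X] is determined by [X] up to homomorphism, the values of [f] on the diagonal
    matrix units of truncated free algebras define coefficients [c_w], which are nonnegative by
    positivity, and [f X = sum_w c_w X_w] whenever [X] is nilpotent.

    A Schur spectral contraction [X] is a block of a positive definite tuple [Y] over a product
    built from one algebra [A], so it suffices to treat [Y].  Fix [T > 1] such that [T Y] is still
    contractive, and put [Z = Y (x) Psi] over [A (x) M_N], with [Psi] a positive kernel on the
    states of a clock.  Then [f Z] is a polynomial in [Z]; write [P_m] for its degree [m] part,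
    evaluated at [Y].  Each entry of [Psi] weighs the [P_m] by a sequence in [m].  With the
    weights 1 and [T^m] one reads off [f Y] and [f (T Y)]; a nilpotent block gives
    [P_m = sum_(|w| = m) c_w Y_w] for [m <= M]; and positivity of [f Z] gives
    [sum_(m > M) P_m >= 0] and [sum_(m > M) (T^(m - M) - 1) P_m >= 0].  Hence
      [0 <= f Y - sum_(|w| <= M) c_w Y_w <= T^(-M) f (T Y)],
    which tends to 0. *)

(* Inside the module [<] on [nat] is the boolean order, whereas the theorem uses Peano's. *)
Module Schur.

(** * Growth rates of words *)

(** Nothing like continuity of [f] is available: [f X] is a polynomial in [X], but one that varies
    with [X] and whose coefficients have no sign. Values of [f] at different tuples can be compared
    only along homomorphisms, which is why a single [Z] is built that has [Y], [T Y] and a nilpotent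
    truncation of [Y] among its images: one polynomial then serves for all of them. Since the degree
    parts beyond [M] are not known to be positive one by one, only sums of them that arise from
    [f Z] can be used, and these come from testing [f Z] on the difference of two clock states.

    A second obstacle is that membership among the contractions demands a strictly positive block
    matrix and an existing limit of roots, while the tuples constructed here are only semidefinite.
    Geometric bounds on word products replace the spectral radius; they survive a small multiple of
    the identity, which restores strictness, and Fekete's lemma turns them back into a limit. *)

Lemma Rsum_le N F G : (forall i, (i < N)%nat -> F i <= G i) -> Rsum N F <= Rsum N G.
Proof.
induction N as [|N IH]; intros H; simpl; [lra|].
apply Rplus_le_compat; [apply IH; intros i Hi; apply H; lia | apply H; lia].
Qed.

Lemma Rsum_const N b : Rsum N (fun _ => b) = INR N * b.
Proof. induction N as [|N IH]; [simpl; lra|]. rewrite S_INR. simpl. rewrite IH. lra. Qed.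

Lemma Rsum_ge0 N F : (forall i, (i < N)%nat -> 0 <= F i) -> 0 <= Rsum N F.
Proof.
intros H. replace 0 with (Rsum N (fun _ => 0)) by (rewrite Rsum_const; lra).
now apply Rsum_le.
Qed.

Lemma Rsum_term N F k : (forall i, (i < N)%nat -> 0 <= F i) -> (k < N)%nat -> F k <= Rsum N F.
Proof.
induction N as [|N IH]; intros H Hk; [lia|]. simpl.
destruct (Nat.eq_dec k N) as [->|ne].
- assert (0 <= Rsum N F) by (apply Rsum_ge0; intros; apply H; lia). lra.
- assert (F k <= Rsum N F) by (apply IH; [intros; apply H; lia | lia]).
  assert (0 <= F N) by (apply H; lia). lra.
Qed.

Lemma Cabs_ge0 z : 0 <= Cabs z.
Proof. apply sqrt_pos. Qed.

Lemma Cabs_le_mnorm N Y i j : (i < N)%nat -> (j < N)%nat -> Cabs (Y i j) <= mnorm N Y.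
Proof.
intros Hi Hj. unfold mnorm. rewrite <- (sqrt_square (Cabs (Y i j))) by apply Cabs_ge0.
apply sqrt_le_1_alt.
assert (P : forall k l, 0 <= Cabs (Y k l) * Cabs (Y k l)).
{ intros. apply Rmult_le_pos; apply Cabs_ge0. }
apply Rle_trans with (Rsum N (fun j => Cabs (Y i j) * Cabs (Y i j))).
- now apply (Rsum_term N (fun j => Cabs (Y i j) * Cabs (Y i j))).
- apply (Rsum_term N (fun i => Rsum N (fun j => Cabs (Y i j) * Cabs (Y i j)))); auto.
  intros. now apply Rsum_ge0.
Qed.

Lemma mnorm_le N Y b : 0 <= b ->
  (forall i j, (i < N)%nat -> (j < N)%nat -> Cabs (Y i j) <= b) -> mnorm N Y <= INR N * b.
Proof.
intros Hb H. unfold mnorm.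
assert (HN := pos_INR N).
rewrite <- (sqrt_square (INR N * b)) by now apply Rmult_le_pos.
apply sqrt_le_1_alt.
apply Rle_trans with (Rsum N (fun _ => INR N * (b * b))).
- apply Rsum_le. intros i Hi. rewrite <- Rsum_const. apply Rsum_le. intros j Hj.
  apply Rmult_le_compat; auto using Cabs_ge0.
- rewrite Rsum_const. apply Req_le. ring.
Qed.

Lemma in_words d k w : In w (words d k) <-> is_word d w /\ length w = k.
Proof.
revert w. induction k as [|k IH]; intros w; simpl.
- split; [intros [<-|[]]; split; [constructor|reflexivity]|].
  intros [_ H]. left. destruct w; [reflexivity|discriminate].
- rewrite in_flat_map. split.
  + intros [v [Hv Hw]]. apply in_map_iff in Hw as [i [<- Hi]].
    apply IH in Hv as [Hv <-]. apply in_seq in Hi.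
    split; [constructor; [lia|exact Hv] | reflexivity].
  + intros [Hw Hl]. destruct w as [|i v]; [discriminate|].
    inversion Hw; subst. exists v. split; [apply IH; split; auto|].
    apply in_map_iff. exists i. split; [reflexivity|]. apply in_seq. lia.
Qed.

Lemma mnorm_le_maxnorm s d Y w : is_word d w ->
  mnorm (gn s) (wprod s Y w) <= maxnorm s d Y (length w).
Proof.
intros Hw. assert (H : In w (words d (length w))) by now apply in_words.
unfold maxnorm. induction (words d (length w)) as [|v l IH]; [easy|]. simpl.
destruct H as [->|H]; [apply Rmax_l|].
eapply Rle_trans; [now apply IH | apply Rmax_r].
Qed.

Lemma maxnorm_ge0 s d Y k : 0 <= maxnorm s d Y k.
Proof.
unfold maxnorm. induction (words d k) as [|v l IH]; simpl; [lra|].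
eapply Rle_trans; [exact IH | apply Rmax_r].
Qed.

Lemma maxnorm_le s d Y k b : 0 <= b ->
  (forall w, is_word d w -> length w = k -> mnorm (gn s) (wprod s Y w) <= b) ->
  maxnorm s d Y k <= b.
Proof.
intros Hb H. assert (G : forall w, In w (words d k) -> mnorm (gn s) (wprod s Y w) <= b).
{ intros w Hw. apply in_words in Hw as [? ?]. auto. }
unfold maxnorm. induction (words d k) as [|v l IH]; simpl; [lra|].
apply Rmax_lub; [apply G; now left | apply IH; intros; apply G; now right].
Qed.

Lemma rootk_ge0 k x : 0 <= rootk k x.
Proof.
unfold rootk. destruct (Rle_dec x 0); [lra|]. unfold Rpower. left. apply exp_pos.
Qed.

Lemma rootk_pow k x : 0 < x -> rootk (S k) x ^ S k = x.
Proof.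
intros Hx. unfold rootk. destruct (Rle_dec x 0); [lra|].
rewrite <- Rpower_pow by apply exp_pos. rewrite Rpower_mult, Rinv_l.
- now apply Rpower_1.
- apply not_0_INR. lia.
Qed.

Lemma le_rootk_pow k x : x <= rootk (S k) x ^ S k.
Proof.
destruct (Rle_dec x 0) as [H|H].
- apply Rle_trans with 0; [exact H|]. apply pow_le, rootk_ge0.
- rewrite rootk_pow; lra.
Qed.

Lemma pow_lt_mono k y z : 0 <= y < z -> y ^ S k < z ^ S k.
Proof.
intros [Hy H]. induction k as [|k IH]; [simpl; lra|].
change (y * y ^ S k < z * z ^ S k).
assert (0 <= y ^ S k) by now apply pow_le.
apply Rle_lt_trans with (z * y ^ S k).
- apply Rmult_le_compat_r; lra.
- apply Rmult_lt_compat_l; lra.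
Qed.

Lemma rootk_le k x y : 0 <= y -> x <= y ^ S k -> rootk (S k) x <= y.
Proof.
intros Hy H. destruct (Rle_dec x 0) as [Hx|Hx].
- unfold rootk. destruct (Rle_dec x 0); lra.
- destruct (Rle_lt_dec (rootk (S k) x) y) as [|G]; [assumption|].
  exfalso. assert (y ^ S k < rootk (S k) x ^ S k) by (apply pow_lt_mono; lra).
  rewrite rootk_pow in H0; lra.
Qed.

(** The ratio [(y / z) ^ n] tends to 0 and absorbs any constant. In the root estimates below this
    trades a constant factor for a slightly larger base. *)
Lemma pow_dominates M y z : 0 <= y < z -> exists N, forall n, (N <= n)%nat -> M * y ^ n <= z ^ n.
Proof.
intros [Hy H].
destruct (pow_lt_1_zero (y / z)) with (y := / (Rabs M + 1)) as [N HN].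
- rewrite Rabs_pos_eq; [apply Rmult_lt_reg_r with z; [lra|]; field_simplify; lra|].
  apply Rmult_le_pos; [lra|]. left. apply Rinv_0_lt_compat. lra.
- apply Rinv_0_lt_compat. assert (h := Rabs_pos M). lra.
- exists N. intros n Hn. specialize (HN n Hn).
  assert (hM := Rabs_pos M). assert (zn : 0 < z ^ n) by (apply pow_lt; lra).
  assert (q0 : 0 <= (y / z) ^ n).
  { apply pow_le. apply Rmult_le_pos; [lra|]. left. apply Rinv_0_lt_compat. lra. }
  rewrite Rabs_pos_eq in HN by exact q0.
  replace (y ^ n) with ((y / z) ^ n * z ^ n) by (rewrite <- Rpow_mult_distr; f_equal; field; lra).
  rewrite <- Rmult_assoc. rewrite <- (Rmult_1_l (z ^ n)) at 2.
  apply Rmult_le_compat_r; [lra|].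
  apply Rle_trans with ((Rabs M + 1) * (y / z) ^ n).
  + apply Rmult_le_compat_r; [exact q0|]. assert (h := Rle_abs M). lra.
  + apply Rmult_le_reg_l with (/ (Rabs M + 1)); [apply Rinv_0_lt_compat; lra|].
    field_simplify; lra.
Qed.

(* Fekete's lemma in multiplicative form; it also covers sequences that vanish eventually. *)
Lemma submultiplicative_root_limit (a : nat -> R) (K C rho : R) :
  (forall k, 0 <= a k) -> 0 < K -> (forall j k, a (j + k)%nat <= K * a j * a k) ->
  0 <= rho < 1 -> (forall k, a k <= C * rho ^ k) ->
  exists L, L < 1 /\ Un_cv (fun k => rootk (S k) (a (S k))) L.
Proof.
intros a0 K0 sub Hr Ha.
(* Rescaling by [K] turns the hypothesis into plain submultiplicativity; the roots of [K] tend to 1,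
   so the limit is unaffected. *)
set (b := fun k => K * a k).
assert (b0 : forall k, 0 <= b k) by (intros; apply Rmult_le_pos; [lra|apply a0]).
assert (bsub : forall j k, b (j + k)%nat <= b j * b k).
{ intros j k. unfold b. specialize (sub j k).
  replace (K * a j * (K * a k)) with (K * (K * a j * a k)) by ring.
  apply Rmult_le_compat_l; lra. }
set (r := fun k => rootk (S k) (b (S k))).
(* [completeness] provides suprema only, so the infimum [L] of the roots of [b] is taken as minus
   the supremum of their negatives. *)
set (E := fun x => exists k, x = - r k).
assert (bE : bound E).
{ exists 0. intros x [k ->]. assert (h := rootk_ge0 (S k) (b (S k))). unfold r. lra. }
destruct (completeness E bE) as [m [ub lub]]; [exists (- r O); now exists O|].
set (L := - m).
assert (Lr : forall k, L <= r k) by (intros k; assert (h := ub (- r k) (ex_intro _ k eq_refl)); unfold L; lra).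
assert (rL : forall e, 0 < e -> exists k, r k < L + e).
{ intros e He. destruct (Classical_Prop.classic (exists k, r k < L + e)) as [|N]; [assumption|].
  exfalso. assert (h : m <= m - e).
  { apply lub. intros x [k ->]. destruct (Rlt_le_dec (r k) (L + e)) as [h|h].
    - exfalso. apply N. now exists k.
    - unfold L in h. lra. }
  lra. }
assert (L0 : 0 <= L).
{ assert (h : m <= 0); [|unfold L; lra].
  apply lub. intros x [k ->]. assert (h := rootk_ge0 (S k) (b (S k))). unfold r. lra. }
exists L. split.
(* As [L] is an infimum, one index at which the root falls to [(1 + rho) / 2] is enough. *)
- destruct (pow_dominates (K * C) rho ((1 + rho) / 2)) as [N HN]; [lra|].
  apply Rle_lt_trans with ((1 + rho) / 2); [|lra].
  apply Rle_trans with (r N); [apply Lr|]. apply rootk_le; [lra|].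
  apply Rle_trans with (K * C * rho ^ S N); [|apply HN; lia].
  unfold b. rewrite Rmult_assoc. apply Rmult_le_compat_l; [lra|apply Ha].
- assert (up : forall e, 0 < e -> exists N, forall n, (N <= n)%nat -> rootk (S n) (a (S n)) <= L + 2 * e).
  (* Fekete's argument: the root at [p] is within [e] of [L]; writing an index as [q * p + i] gives
     [b n <= M * y ^ n], where [M] covers the residues [i < p]. The second [e] in [L + 2 * e] pays
     for the factor [M / K]. *)
  { intros e He. destruct (rL e He) as [k0 Hk0].
    set (p := S k0). set (y := L + e). assert (y0 : 0 < y) by (unfold y; lra).
    assert (bp : b p <= y ^ p).
    { eapply Rle_trans; [apply le_rootk_pow|]. apply pow_incr. split; [apply rootk_ge0|].
      change (r k0 <= L + e). lra. }
    assert (HM : exists M, 0 <= M /\ forall i, (i < p)%nat -> b i <= M * y ^ i).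
    { clear - y0 b0. clearbody p y b. induction p as [|q IH].
      - exists 0. split; [lra|]. intros i Hi. lia.
      - destruct IH as [M [HM H]]. exists (M + b q / y ^ q).
        assert (yq : 0 < y ^ q) by now apply pow_lt.
        assert (h : 0 <= b q / y ^ q) by (apply Rmult_le_pos; [apply b0|left; now apply Rinv_0_lt_compat]).
        split; [lra|]. intros i Hi. destruct (Nat.eq_dec i q) as [->|ne].
        + rewrite Rmult_plus_distr_r. unfold Rdiv at 1. rewrite (Rmult_assoc (b q)), Rinv_l by lra.
          assert (0 <= M * y ^ q) by (apply Rmult_le_pos; lra). lra.
        + apply Rle_trans with (M * y ^ i); [apply H; lia|].
          apply Rmult_le_compat_r; [left; now apply pow_lt|lra]. }
    destruct HM as [M [HM0 HM]].
    assert (bq : forall q i, (i < p)%nat -> b (q * p + i)%nat <= M * y ^ (q * p + i)).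
    { induction q as [|q IH]; intros i Hi; [now apply HM|].
      replace (S q * p + i)%nat with (p + (q * p + i))%nat by lia.
      rewrite pow_add. eapply Rle_trans; [apply bsub|].
      replace (M * (y ^ p * y ^ (q * p + i))) with (y ^ p * (M * y ^ (q * p + i))) by ring.
      apply Rmult_le_compat; auto. }
    assert (bn : forall n, b n <= M * y ^ n).
    { intros n. rewrite (Nat.div_mod_eq n p), Nat.mul_comm. apply bq. apply Nat.mod_upper_bound.
      unfold p. lia. }
    destruct (pow_dominates (M / K) y (L + 2 * e)) as [N HN]; [unfold y in *; lra|].
    exists N. intros n Hn. apply rootk_le; [lra|].
    apply Rle_trans with (M / K * y ^ S n); [|apply HN; lia].
    apply Rmult_le_reg_l with K; [lra|]. fold (b (S n)).
    replace (K * (M / K * y ^ S n)) with (M * y ^ S n) by (field; lra). apply bn. }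
  assert (lo : forall e, 0 < e -> exists N, forall n, (N <= n)%nat -> L - e <= rootk (S n) (a (S n))).
  { intros e He. destruct (Rle_lt_dec L e) as [h|h].
    - exists O. intros n _. assert (g := rootk_ge0 (S n) (a (S n))). lra.
    (* Should the root of [a] drop below [L - e], the root of [b] would for large [n] be at most
       [L - e / 2], below the infimum. *)
    - destruct (pow_dominates K (L - e) (L - e / 2)) as [N HN]; [lra|].
      exists N. intros n Hn. destruct (Rle_lt_dec (L - e) (rootk (S n) (a (S n)))) as [|g]; [assumption|].
      exfalso. assert (r n <= L - e / 2); [|assert (q := Lr n); lra].
      apply rootk_le; [lra|]. apply Rle_trans with (K * (L - e) ^ S n); [|apply HN; lia].
      apply Rmult_le_compat_l; [lra|]. eapply Rle_trans; [apply le_rootk_pow|].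
      apply pow_incr. split; [apply rootk_ge0|lra]. }
  intros e He. destruct (up (e / 4)) as [N1 H1]; [lra|]. destruct (lo (e / 2)) as [N2 H2]; [lra|].
  exists (max N1 N2). intros n Hn. unfold R_dist. apply Rabs_def1.
  + assert (h := H1 n ltac:(lia)). lra.
  + assert (h := H2 n ltac:(lia)). lra.
Qed.

Lemma root_limit_geometric (a : nat -> R) (L : R) :
  (forall k, 0 <= a k) -> L < 1 -> Un_cv (fun k => rootk (S k) (a (S k))) L ->
  exists C rho, 0 <= C /\ 0 <= rho < 1 /\ forall k, a k <= C * rho ^ k.
Proof.
(* A rate strictly between [L] and 1; the maximum with 0 keeps it positive, since the initial terms
   are divided by its powers. *)
intros a0 HL cv. set (rho := (1 + Rmax L 0) / 2).
assert (hr : 0 < rho < 1 /\ L < rho).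
{ unfold rho, Rmax. destruct (Rle_dec L 0); lra. }
destruct (cv (rho - L)) as [N HN]; [lra|].
(* The finitely many terms up to [N] fix the constant; [1 <= C] makes it serve the tail as well,
   where [a k <= rho ^ k]. *)
assert (HC : exists C, 1 <= C /\ forall k, (k <= N)%nat -> a k <= C * rho ^ k).
{ clear HN. induction N as [|q [C [HC H]]].
  - exists (1 + a O). assert (h := a0 O). split; [lra|]. intros k Hk.
    replace k with O by lia. simpl. lra.
  - exists (C + a (S q) / rho ^ S q). assert (rq : 0 < rho ^ S q) by (apply pow_lt; lra).
    assert (h : 0 <= a (S q) / rho ^ S q)
      by (apply Rmult_le_pos; [apply a0|left; now apply Rinv_0_lt_compat]).
    split; [lra|]. intros k Hk. destruct (Nat.eq_dec k (S q)) as [->|ne].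
    + rewrite Rmult_plus_distr_r. unfold Rdiv at 1. rewrite (Rmult_assoc (a (S q))), Rinv_l by lra.
      assert (0 <= C * rho ^ S q) by (apply Rmult_le_pos; lra). lra.
    + apply Rle_trans with (C * rho ^ k); [apply H; lia|].
      apply Rmult_le_compat_r; [left; apply pow_lt; lra|lra]. }
destruct HC as [C [HC H]]. exists C, rho. split; [lra|]. split; [lra|].
intros k. destruct (Nat.le_gt_cases k N) as [h|h]; [now apply H|].
destruct k as [|k]; [lia|]. specialize (HN k ltac:(lia)). unfold R_dist in HN.
apply Rabs_def2 in HN as [HN _].
apply Rle_trans with (1 * rho ^ S k).
- rewrite Rmult_1_l. eapply Rle_trans; [apply le_rootk_pow|]. apply pow_incr.
  split; [apply rootk_ge0|lra].
- apply Rmult_le_compat_r; [left; apply pow_lt; lra|lra].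
Qed.

Import all_boot all_order all_algebra spectral complex Rstruct ring lra zify.
Set Implicit Arguments. Unset Strict Implicit. Unset Printing Implicit Defensive.
Import Order.TTheory GRing.Theory Num.Theory.
Local Open Scope ring_scope.

(** * Algebras given by structure constants *)

Section StructureConstants.
Variable C : numClosedFieldType.

Definition amul (I : finType) (g : I -> I -> I -> C) (x y : I -> C) (k : I) : C :=
  \sum_i \sum_j x i * y j * g i j k.

Definition aassoc (I : finType) (g : I -> I -> I -> C) :=
  forall i j l p, \sum_k g i j k * g k l p = \sum_k g j l k * g i k p.

Definition aunit (I : finType) (g : I -> I -> I -> C) (u : I -> C) :=
  (forall j k, \sum_i u i * g i j k = (j == k)%:R) /\
  (forall i k, \sum_j u j * g i j k = (i == k)%:R).

Lemma eq_amul (I : finType) (g g' : I -> I -> I -> C) (x x' y y' : I -> C) :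
  (forall i j, g i j =1 g' i j) -> x =1 x' -> y =1 y' ->
  amul g x y =1 amul g' x' y'.
Proof.
move=> eg ex ey k; apply: eq_bigr => i _; apply: eq_bigr => j _.
by rewrite ex ey eg.
Qed.

Lemma amulA (I : finType) (g : I -> I -> I -> C) (x y z : I -> C) : aassoc g ->
  amul g (amul g x y) z =1 amul g x (amul g y z).
Proof.
move=> gA p; rewrite /amul.
transitivity (\sum_i \sum_j \sum_l x i * y j * z l * \sum_k g i j k * g k l p).
  transitivity (\sum_k \sum_i \sum_j \sum_l x i * y j * z l * (g i j k * g k l p)).
    apply: eq_bigr => k _.
    rewrite [RHS](eq_bigr (fun i => \sum_l \sum_j x i * y j * z l * (g i j k * g k l p))); last first.
      by move=> i _; rewrite exchange_big.
    rewrite [RHS]exchange_big /=; apply: eq_bigr => l _.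
    rewrite mulr_suml mulr_suml; apply: eq_bigr => i _.
    rewrite mulr_suml mulr_suml; apply: eq_bigr => j _; ring.
  rewrite exchange_big /=; apply: eq_bigr => i _.
  rewrite exchange_big /=; apply: eq_bigr => j _.
  rewrite exchange_big /=; apply: eq_bigr => l _.
  by rewrite mulr_sumr.
apply: eq_bigr => i _.
transitivity (\sum_j \sum_l \sum_k x i * y j * z l * (g j l k * g i k p)).
  apply: eq_bigr => j _; apply: eq_bigr => l _.
  by rewrite gA mulr_sumr.
transitivity (\sum_k \sum_j \sum_l x i * y j * z l * (g j l k * g i k p)).
  rewrite [RHS]exchange_big /=; apply: eq_bigr => j _.
  by rewrite [RHS]exchange_big.
apply: eq_bigr => k _; rewrite mulr_sumr mulr_suml; apply: eq_bigr => j _.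
rewrite mulr_sumr mulr_suml; apply: eq_bigr => l _; ring.
Qed.

Lemma sum_delta (I : finType) (F : I -> C) (k : I) :
  \sum_i F i * (i == k)%:R = F k.
Proof.
rewrite (bigD1 k) //= eqxx mulr1 big1 ?addr0 // => i /negPf ->.
by rewrite mulr0.
Qed.

Lemma amul1l (I : finType) (g : I -> I -> I -> C) u x : aunit g u ->
  amul g u x =1 x.
Proof.
move=> [gu _] k; rewrite /amul exchange_big /= -[RHS](sum_delta x).
apply: eq_bigr => j _; rewrite -gu mulr_sumr; apply: eq_bigr => i _; ring.
Qed.

Lemma amul1r (I : finType) (g : I -> I -> I -> C) u x : aunit g u ->
  amul g x u =1 x.
Proof.
move=> [_ gu] k; rewrite /amul -[RHS](sum_delta x).
apply: eq_bigr => j _; rewrite -gu mulr_sumr; apply: eq_bigr => i _; ring.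
Qed.

Definition atens (I J : finType) (g : I -> I -> I -> C) (h : J -> J -> J -> C)
  (a b c : I * J) : C := g a.1 b.1 c.1 * h a.2 b.2 c.2.

Lemma sum_prod (I J : finType) (F : I -> C) (G : J -> C) :
  \sum_(a : I * J) F a.1 * G a.2 = (\sum_i F i) * (\sum_j G j).
Proof.
rewrite mulr_suml -(pair_bigA _ (fun i j => F i * G j)) /=.
by apply: eq_bigr => i _; rewrite mulr_sumr.
Qed.

Lemma atens_assoc (I J : finType) (g : I -> I -> I -> C) (h : J -> J -> J -> C) :
  aassoc g -> aassoc h -> aassoc (atens g h).
Proof.
move=> gA hA a b c e; rewrite /atens.
have E (F F' : I -> C) (G G' : J -> C) :
  \sum_(k : I * J) F k.1 * G k.2 * (F' k.1 * G' k.2) =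
  (\sum_i F i * F' i) * (\sum_j G j * G' j).
  rewrite -(sum_prod (fun i => F i * F' i) (fun j => G j * G' j)).
  by apply: eq_bigr => k _; rewrite /=; ring.
rewrite (E (g a.1 b.1) (fun k => g k c.1 e.1) (h a.2 b.2) (fun k => h k c.2 e.2)).
rewrite (E (g b.1 c.1) (fun k => g a.1 k e.1) (h b.2 c.2) (fun k => h a.2 k e.2)).
by rewrite gA hA.
Qed.

Lemma atens_unit (I J : finType) (g : I -> I -> I -> C) (h : J -> J -> J -> C) u v :
  aunit g u -> aunit h v -> aunit (atens g h) (fun a => u a.1 * v a.2).
Proof.
move=> [gl gr] [hl hr]; split => a b; rewrite /atens.
  transitivity ((\sum_i u i * g i a.1 b.1) * (\sum_j v j * h j a.2 b.2)).
    rewrite -(sum_prod (fun i => u i * g i a.1 b.1) (fun j => v j * h j a.2 b.2)).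
    by apply: eq_bigr => i _ /=; ring.
  by rewrite gl hl -natrM mulnb -xpair_eqE -!surjective_pairing.
transitivity ((\sum_i u i * g a.1 i b.1) * (\sum_j v j * h a.2 j b.2)).
  rewrite -(sum_prod (fun i => u i * g a.1 i b.1) (fun j => v j * h a.2 j b.2)).
  by apply: eq_bigr => i _ /=; ring.
by rewrite gr hr -natrM mulnb -xpair_eqE -!surjective_pairing.
Qed.

(** The columns of a matrix enter through [v_B(b)^*], so their algebra acts with conjugated
    constants. *)
Definition aconj (I : finType) (g : I -> I -> I -> C) (i j k : I) : C := (g i j k)^*.

Lemma aconj_assoc (I : finType) (g : I -> I -> I -> C) : aassoc g -> aassoc (aconj g).
Proof.
move=> gA i j l p; rewrite /aconj.
under eq_bigr do rewrite -rmorphM; under [RHS]eq_bigr do rewrite -rmorphM.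
by rewrite -!rmorph_sum gA.
Qed.

Lemma aconj_unit (I : finType) (g : I -> I -> I -> C) u :
  aunit g u -> aunit (aconj g) (fun i => (u i)^*).
Proof.
move=> [gl gr]; split => i k; rewrite /aconj.
  under eq_bigr do rewrite -rmorphM.
  by rewrite -rmorph_sum gl rmorph_nat.
under eq_bigr do rewrite -rmorphM.
by rewrite -rmorph_sum gr rmorph_nat.
Qed.

(** Structure constants of the matrix algebra M_J: [a] stands for the matrix unit with row [a.1] and
    column [a.2]. *)
Definition amx (J : finType) (a b c : J * J) : C :=
  [&& a.2 == b.1, c.1 == a.1 & c.2 == b.2]%:R.

Lemma amx_assoc (J : finType) : aassoc (@amx J).
Proof.
move=> [i i'] [j j'] [l l'] [p p']; rewrite /amx /=.
rewrite (bigD1 (i, j')) //= !eqxx !andbT big1 ?addr0; last first.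
  move=> [k k'] /=; rewrite xpair_eqE => /negPf E; rewrite -natrM mulnb.
  by rewrite -andbA andbCA andbA; case: (k == i) E => //=; case: (k' == j') => //=;
    rewrite ?andbF.
rewrite (bigD1 (j, l')) //= !eqxx !andbT big1 ?addr0; last first.
  move=> [k k'] /=; rewrite xpair_eqE => /negPf E; rewrite -natrM mulnb.
  by case: (k == j) E => //=; case: (k' == l') => //=; rewrite ?andbF.
rewrite -!natrM !mulnb; congr (nat_of_bool _)%:R.
by case: (i' == j); case: (j' == l); case: (p == i); case: (p' == l').
Qed.

Lemma amx_unit (J : finType) : aunit (@amx J) (fun a => (a.1 == a.2)%:R).
Proof.
split => -[i i'] [k k']; rewrite /amx /= xpair_eqE.
  rewrite (bigD1 (i, i)) //= !eqxx mul1r big1 ?addr0 /=; last first.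
    move=> [a a'] /=; rewrite xpair_eqE -natrM mulnb.
    by have [->|] //= := eqVneq a a'; rewrite andbb => /negPf ->.
  by rewrite eq_sym; congr (nat_of_bool (_ && _))%:R; rewrite eq_sym.
rewrite (bigD1 (i', i')) //= !eqxx mul1r big1 ?addr0 /=; last first.
  move=> [a a'] /=; rewrite xpair_eqE -natrM mulnb.
  by have [->|] //= := eqVneq a a'; rewrite andbb (eq_sym i') => /negPf ->.
by rewrite eq_sym; congr (nat_of_bool (_ && _))%:R; rewrite eq_sym.
Qed.

End StructureConstants.

(* Sealing the type keeps [ring] and unification from unfolding the real numbers. *)
Definition CC : numClosedFieldType := (R[i] : numClosedFieldType).
Definition toC (z : Cplx) : CC := Complex (fst z) (snd z).
Definition ofC (z : CC) : Cplx := let: Complex a b := z in (a, b).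

Lemma toCK : cancel toC ofC. Proof. by case. Qed.
Lemma ofCK : cancel ofC toC. Proof. by case. Qed.
Lemma toC_inj : injective toC. Proof. exact: can_inj toCK. Qed.
Lemma toC0 : toC Defs.C0 = 0. Proof. by []. Qed.
Lemma toC1 : toC Defs.C1 = 1. Proof. by []. Qed.
Lemma toCD a b : toC (Cadd a b) = toC a + toC b. Proof. by []. Qed.
Lemma toCM a b : toC (Cmul a b) = toC a * toC b. Proof. by []. Qed.
Lemma toCJ a : toC (Cconj a) = (toC a)^*. Proof. by []. Qed.

Lemma toC_ge0 z : 0 <= toC z <-> Cim z = R0 /\ Rle R0 (Cre z).
Proof.
rewrite lecE /=; split; first by move=> /andP[/eqP h1 /RleP h2].
by case=> h1 h2; apply/andP; split; [apply/eqP | apply/RleP].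
Qed.

Lemma toC_Csum n F : toC (Csum n F) = \sum_(i < n) toC (F i).
Proof. by elim: n => [|n IH]; rewrite ?big_ord0 // big_ord_recr /= toCD IH. Qed.

Lemma toC_sprod s X Y p q : toC (sprod s X Y p q) =
  \sum_(i < gn s) \sum_(j < gm s) \sum_(k < gn s) \sum_(l < gm s)
    toC (X i j) * toC (Y k l) * (toC (ga s i k p) * (toC (gb s j l q))^*).
Proof.
rewrite toC_Csum; apply: eq_bigr => i _; rewrite toC_Csum; apply: eq_bigr => j _.
rewrite toC_Csum; apply: eq_bigr => k _; rewrite toC_Csum; apply: eq_bigr => l _.
by rewrite !toCM toCJ.
Qed.

Lemma meqP n m X Y :
  meq n m X Y <-> (forall (i : 'I_n) (j : 'I_m), toC (X i j) = toC (Y i j)).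
Proof.
split; first by move=> E i j; rewrite E //; apply/ssrnat.ltP.
by move=> E i j /ssrnat.ltP hi /ssrnat.ltP hj; apply: toC_inj (E (Ordinal hi) (Ordinal hj)).
Qed.

Definition cst n (g : nat -> nat -> nat -> Cplx) (i j k : 'I_n) : CC := toC (g i j k).

Lemma toC_vmul n g x y (k : 'I_n) :
  toC (vmul n g x y k) = amul (cst g) (fun i : 'I_n => toC (x i)) (fun i : 'I_n => toC (y i)) k.
Proof.
rewrite toC_Csum; apply: eq_bigr => i _; rewrite toC_Csum; apply: eq_bigr => j _.
by rewrite !toCM.
Qed.

Definition ndelta (i j : nat) : Cplx := if i == j then Defs.C1 else Defs.C0.
Lemma toC_ndelta i j : toC (ndelta i j) = (i == j)%:R.
Proof. by rewrite /ndelta; case: (i == j). Qed.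

Lemma veqP n x y : veq n x y <-> (forall k : 'I_n, toC (x k) = toC (y k)).
Proof.
split; first by move=> E k; rewrite E //; apply/ssrnat.ltP.
by move=> E k /ssrnat.ltP hk; apply: toC_inj (E (Ordinal hk)).
Qed.

(** The identities are multilinear, so they may be tested on basis vectors; [D i] is the [i]-th
    one. *)
Lemma is_ualgP n g u :
  is_ualg n g u <-> aassoc (@cst n g) /\ aunit (@cst n g) (fun i => toC (u i)).
Proof.
pose D (i : 'I_n) (j : 'I_n) : CC := (j == i)%:R.
have Dl (x : 'I_n -> CC) (i k : 'I_n) : amul (cst g) (D i) x k = \sum_j x j * cst g i j k.
  rewrite /amul (bigD1 i) //= [X in _ + X]big1 ?addr0.
    by apply: eq_bigr => j _; rewrite /D eqxx mul1r.
  by move=> a /negPf E; apply: big1 => b _; rewrite /D E !mul0r.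
have Dr (x : 'I_n -> CC) (j k : 'I_n) : amul (cst g) x (D j) k = \sum_i x i * cst g i j k.
  rewrite /amul; apply: eq_bigr => i _; rewrite (bigD1 j) //= big1 ?addr0.
    by rewrite /D eqxx mulr1.
  by move=> a /negPf E; rewrite /D E mulr0 mul0r.
have DE (i : 'I_n) : (fun j : 'I_n => toC (ndelta i j)) =1 D i.
  by move=> j; rewrite toC_ndelta /D eq_sym.
split.
  move=> [A [L U]]; split; last split.
  - move=> i j l p; have /veqP /(_ p) := A (ndelta i) (ndelta j) (ndelta l).
    rewrite !toC_vmul.
    have F (a b k : 'I_n) : toC (vmul n g (ndelta a) (ndelta b) k) = cst g a b k.
      rewrite toC_vmul (eq_amul (fun _ _ _ => erefl) (DE a) (DE b)) Dl.
      rewrite -[RHS](sum_delta (fun j => cst g a j k) b).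
      by apply: eq_bigr => c _; rewrite mulrC.
    rewrite (eq_amul (fun _ _ _ => erefl) (F i j) (DE l)) Dr => ->.
    by rewrite (eq_amul (fun _ _ _ => erefl) (DE i) (F j l)) Dl.
  - move=> j k; have /veqP /(_ k) := L (ndelta j).
    by rewrite toC_vmul (eq_amul (fun _ _ _ => erefl) (fun _ => erefl) (DE j)) Dr toC_ndelta.
  - move=> j k; have /veqP /(_ k) := U (ndelta j).
    by rewrite toC_vmul (eq_amul (fun _ _ _ => erefl) (DE j) (fun _ => erefl)) Dl toC_ndelta.
move=> [A U]; split; last split.
- move=> x y z; apply/veqP => p; rewrite !toC_vmul.
  rewrite (eq_amul (fun _ _ _ => erefl) (@toC_vmul n g x y) (fun _ => erefl)) amulA //.
  by apply: eq_amul => // k; rewrite toC_vmul.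
- by move=> x; apply/veqP => p; rewrite toC_vmul amul1l.
- by move=> x; apply/veqP => p; rewrite toC_vmul amul1r.
Qed.

(* [sprod s] is the product of the algebra A (x) conj(B). *)
Definition sst s := atens (@cst (gn s) (ga s)) (aconj (@cst (gm s) (gb s))).
Arguments sst : clear implicits.
Definition cM s (X : Mat) (a : 'I_(gn s) * 'I_(gm s)) : CC := toC (X a.1 a.2).
Arguments cM : clear implicits.

Lemma cM_sprod s X Y : cM s (sprod s X Y) =1 amul (sst s) (cM s X) (cM s Y).
Proof.
move=> [p q]; rewrite /cM toC_sprod /amul pair_bigA /=.
apply: eq_bigr => -[i j] _; rewrite pair_bigA /=.
by apply: eq_bigr => -[k l] _.
Qed.

Lemma sst_assoc s : is_gsp s -> aassoc (sst s).
Proof.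
move=> [/is_ualgP[gA _] /is_ualgP[gB _]].
by apply: atens_assoc => //; apply: aconj_assoc.
Qed.

Lemma sst_unit s : is_gsp s -> aunit (sst s) (cM s (sident s)).
Proof.
move=> [/is_ualgP[_ uA] /is_ualgP[_ uB]].
exact: (atens_unit uA (aconj_unit uB)).
Qed.

Lemma meq_cM s X Y : meq (gn s) (gm s) X Y <-> cM s X =1 cM s Y.
Proof.
split; first by move/meqP => E [i j]; apply: E.
by move=> E; apply/meqP => i j; apply: (E (i, j)).
Qed.

Lemma meq_at s X Y : meq (gn s) (gm s) X Y -> forall a, cM s X a = cM s Y a.
Proof. by move/meq_cM. Qed.

Lemma sprod_ext s X X' Y Y' : meq (gn s) (gm s) X X' -> meq (gn s) (gm s) Y Y' ->
  meq (gn s) (gm s) (sprod s X Y) (sprod s X' Y').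
Proof.
move=> /meq_cM EX /meq_cM EY; apply/meq_cM => a; rewrite !cM_sprod.
exact: eq_amul.
Qed.

Lemma sprodA s X Y Z : is_gsp s ->
  meq (gn s) (gm s) (sprod s (sprod s X Y) Z) (sprod s X (sprod s Y Z)).
Proof.
move=> hs; apply/meq_cM => a.
rewrite !cM_sprod (eq_amul (fun _ _ _ => erefl) (@cM_sprod s X Y) (fun _ => erefl)).
rewrite amulA; last exact: sst_assoc.
by apply: eq_amul => // b; rewrite cM_sprod.
Qed.

Lemma sprod1l s X : is_gsp s -> meq (gn s) (gm s) (sprod s (sident s) X) X.
Proof.
by move=> hs; apply/meq_cM => a; rewrite cM_sprod amul1l //; apply: sst_unit.
Qed.

Lemma sprod1r s X : is_gsp s -> meq (gn s) (gm s) (sprod s X (sident s)) X.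
Proof.
by move=> hs; apply/meq_cM => a; rewrite cM_sprod amul1r //; apply: sst_unit.
Qed.

Lemma meq_refl n m X : meq n m X X. Proof. by []. Qed.
Lemma meq_sym n m X Y : meq n m X Y -> meq n m Y X.
Proof. by move=> E i j hi hj; rewrite E. Qed.
Lemma meq_trans n m Y X Z : meq n m X Y -> meq n m Y Z -> meq n m X Z.
Proof. by move=> E F i j hi hj; rewrite E ?F. Qed.

Lemma wprod_cat s X v w : is_gsp s ->
  meq (gn s) (gm s) (wprod s X (v ++ w)) (sprod s (wprod s X v) (wprod s X w)).
Proof.
move=> hs; elim: v => [|i v IH] /=; first exact/meq_sym/sprod1l.
apply: meq_trans (sprod_ext (@meq_refl _ _ _) IH) _.
exact/meq_sym/sprodA.
Qed.

(** * Homomorphisms and perturbation *)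

Section Bilinear.
Variable C : numClosedFieldType.
Variables (I : finType) (g : I -> I -> I -> C).

Lemma amul_suml (T : Type) (r : seq T) (c : T -> C) (F : T -> I -> C) y k :
  amul g (fun i => \sum_(a <- r) c a * F a i) y k = \sum_(a <- r) c a * amul g (F a) y k.
Proof.
under [RHS]eq_bigr do rewrite /amul mulr_sumr.
rewrite exchange_big /=; apply: eq_bigr => i _.
under [RHS]eq_bigr do rewrite mulr_sumr.
rewrite exchange_big /=; apply: eq_bigr => j _.
by rewrite !mulr_suml; apply: eq_bigr => a _; ring.
Qed.

Lemma amul_sumr (T : Type) (r : seq T) (c : T -> C) (F : T -> I -> C) x k :
  amul g x (fun i => \sum_(a <- r) c a * F a i) k = \sum_(a <- r) c a * amul g x (F a) k.
Proof.
under [RHS]eq_bigr do rewrite /amul mulr_sumr.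
rewrite exchange_big /=; apply: eq_bigr => i _.
under [RHS]eq_bigr do rewrite mulr_sumr.
rewrite exchange_big /=; apply: eq_bigr => j _.
by rewrite mulr_sumr mulr_suml; apply: eq_bigr => a _; ring.
Qed.

Lemma amulDl (x x' y : I -> C) k :
  amul g (fun i => x i + x' i) y k = amul g x y k + amul g x' y k.
Proof.
rewrite /amul -big_split; apply: eq_bigr => i _; rewrite -big_split /=.
by apply: eq_bigr => j _; ring.
Qed.

Lemma amulDr (x y y' : I -> C) k :
  amul g x (fun i => y i + y' i) k = amul g x y k + amul g x y' k.
Proof.
rewrite /amul -big_split; apply: eq_bigr => i _; rewrite -big_split /=.
by apply: eq_bigr => j _; ring.
Qed.

Lemma amulZl (c : C) (x y : I -> C) k :
  amul g (fun i => c * x i) y k = c * amul g x y k.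
Proof.
rewrite /amul mulr_sumr; apply: eq_bigr => i _; rewrite mulr_sumr.
by apply: eq_bigr => j _; ring.
Qed.

Lemma amulZr (c : C) (x y : I -> C) k :
  amul g x (fun i => c * y i) k = c * amul g x y k.
Proof.
rewrite /amul mulr_sumr; apply: eq_bigr => i _; rewrite mulr_sumr.
by apply: eq_bigr => j _; ring.
Qed.

(** A crude constant by which the product is bounded in the sup norm of coordinates
    ([amul_bound]). *)
Definition abound : C := \sum_k \sum_i \sum_j `|g i j k|.

Lemma abound_ge0 : 0 <= abound.
Proof. by apply: sumr_ge0 => k _; apply: sumr_ge0 => i _; apply: sumr_ge0 => j _. Qed.

Lemma amul_bound (x y : I -> C) (a b : C) k : 0 <= a -> 0 <= b ->
  (forall i, `|x i| <= a) -> (forall i, `|y i| <= b) ->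
  `|amul g x y k| <= abound * a * b.
Proof.
move=> a0 b0 hx hy.
apply: (@le_trans _ _ ((\sum_i \sum_j `|g i j k|) * a * b)); last first.
  apply: ler_wpM2r => //; apply: ler_wpM2r => //.
  rewrite /abound [X in _ <= X](bigD1 k) //= lerDl.
  by apply: sumr_ge0 => l _; apply: sumr_ge0 => i _; apply: sumr_ge0 => j _.
rewrite !mulr_suml; apply: le_trans (ler_norm_sum _ _ _) _; apply: ler_sum => i _.
rewrite !mulr_suml; apply: le_trans (ler_norm_sum _ _ _) _; apply: ler_sum => j _.
rewrite !normrM mulrC -mulrA; apply: ler_wpM2l => //.
by apply: ler_pM.
Qed.

End Bilinear.

Lemma toC_lincomb s X l p q :
  toC (lincomb s X l p q) = \sum_(wc <- l) toC wc.2 * toC (wprod s X wc.1 p q).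
Proof. by elim: l => [|wc l IH]; rewrite ?big_nil // big_cons -IH. Qed.

(** Noncommutative polynomials are lists of words with coefficients; this is their product. *)
Definition mulwords (l1 l2 : seq (seq nat * Cplx)) : seq (seq nat * Cplx) :=
  [seq (a.1 ++ b.1, Cmul a.2 b.2) | a <- l1, b <- l2].

Lemma sprod_lincomb s X l1 l2 : is_gsp s ->
  meq (gn s) (gm s) (sprod s (lincomb s X l1) (lincomb s X l2)) (lincomb s X (mulwords l1 l2)).
Proof.
move=> hs; apply/meq_cM => a; rewrite cM_sprod.
have E l : cM s (lincomb s X l) =1
    (fun b => \sum_(wc <- l) toC wc.2 * cM s (wprod s X wc.1) b).
  by move=> b; rewrite /cM toC_lincomb.
rewrite (eq_amul (fun _ _ _ => erefl) (E l1) (E l2)) amul_suml E /mulwords.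
rewrite big_allpairs_dep; apply: eq_bigr => -[v c] _ /=.
rewrite amul_sumr mulr_sumr; apply: eq_bigr => -[w e] _ /=.
by rewrite mulrA; congr (_ * _); rewrite -cM_sprod; apply/esym/meq_at/wprod_cat.
Qed.

Definition words_in (d : nat) (l : seq (seq nat * Cplx)) :=
  forall wc, In wc l -> is_word d wc.1.

Lemma words_in_mul d l1 l2 : words_in d l1 -> words_in d l2 -> words_in d (mulwords l1 l2).
Proof.
move=> h1 h2 wc; rewrite /mulwords; elim: l1 h1 => [|a l1 IH] h1 //= /in_app_iff[].
  move=> /in_map_iff[b [<- hb]] /=; apply/Forall_app; split; last exact: h2.
  by apply: h1; left.
by apply: IH => x hx; apply: h1; right.
Qed.

Section Homomorphism.
Variables (d : nat) (s t : GSP) (X Y : nat -> Mat) (phi : Mat -> Mat).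
Hypothesis hs : is_gsp s.
Hypothesis ht : is_gsp t.
Hypothesis phi_ext : forall Z Z', meq (gn s) (gm s) Z Z' -> meq (gn t) (gm t) (phi Z) (phi Z').
Hypothesis phi_add : forall Z W, meq (gn t) (gm t) (phi (madd Z W)) (madd (phi Z) (phi W)).
Hypothesis phi_scale : forall c Z, meq (gn t) (gm t) (phi (mscale c Z)) (mscale c (phi Z)).
Hypothesis phi_words : forall w, is_word d w ->
  meq (gn t) (gm t) (phi (wprod s X w)) (wprod t Y w).

Lemma phi_lincomb l : words_in d l ->
  meq (gn t) (gm t) (phi (lincomb s X l)) (lincomb t Y l).
Proof.
elim: l => [|[w c] l IH] hl /=.
  apply: (@meq_trans _ _ (phi (mscale Defs.C0 mzero))).
    apply: phi_ext => i j _ _; apply: toC_inj.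
    by rewrite /mscale toCM toC0 mul0r.
  apply: meq_trans (phi_scale _ _) _ => i j _ _; apply: toC_inj.
  by rewrite /mscale toCM toC0 mul0r.
apply: meq_trans (phi_add _ _) _ => i j hi hj; rewrite /madd.
rewrite IH //; last by move=> x hx; apply: hl; right.
rewrite phi_scale // /mscale phi_words //.
by apply: (hl (w, c)); left.
Qed.

(** On the generated algebra every element is a polynomial, and a linear map that takes words to
    words takes a polynomial in [X] to the same polynomial in [Y], hence products to products.
    Outside the generated algebra multiplicativity may fail. *)
Lemma is_hom_of_words : is_hom d s X t Y phi.
Proof.
split; first by move=> Z Z' _; apply: phi_ext.
split; first by move=> Z W _ _; apply: phi_add.
split; first by move=> c Z _; apply: phi_scale.
split.
  move=> Z W [l1 [h1 E1]] [l2 [h2 E2]].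
  apply: meq_trans (phi_ext (sprod_ext E1 E2)) _.
  apply: meq_trans (phi_ext (sprod_lincomb _ _ _ hs)) _.
  apply: meq_trans (phi_lincomb (words_in_mul h1 h2)) _.
  apply: meq_trans (meq_sym (sprod_lincomb _ _ _ ht)) _.
  by apply: sprod_ext; apply: meq_sym; [apply: meq_trans (phi_ext E1) _
    | apply: meq_trans (phi_ext E2) _]; apply: phi_lincomb.
split; first exact: (phi_words (Forall_nil _)).
move=> i hi.
have hw : is_word d [:: i] by constructor.
apply: meq_trans (meq_trans (phi_words hw) (sprod1r _ ht)).
exact/phi_ext/meq_sym/(sprod1r _ hs).
Qed.

End Homomorphism.

(** Working form of a joint spectral radius below 1: geometric decay of every entry of the word
    products. For products of the form [sym], it is exchanged with [jsr_lt1] by [geo_of_jsr] and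
    [jsr_of_geo]. *)
Definition geo d s X := exists K rho : CC, [/\ 0 <= K, 0 <= rho, rho < 1 &
  forall w, is_word d w -> forall a, `|cM s (wprod s X w) a| <= K * rho ^+ size w].

(* The norm is controlled by carrying along an unperturbed prefix [v]. *)
Lemma geo_perturb d s X H : is_gsp s -> geo d s X ->
  exists2 e : CC, 0 < e &
    forall i, (forall j, cM s (i j) =1 (fun a => cM s (X j) a + e * cM s H a)) -> geo d s i.
Proof.
move=> hs [K [rho [K0 rho0 rho1 hX]]].
pose B := abound (sst s); have B0 : 0 <= B := abound_ge0 _.
pose h := \sum_a `|cM s H a|.
have h0 : 0 <= h by apply: sumr_ge0.
(* With [e = c / D] the perturbation adds at most [c] to the rate, where [c] is half of the gap
   [1 - rho]; the summand 1 keeps [D] positive. *)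
pose D := B * B * h * K + 1.
have D0 : 0 < D by rewrite ltr_wpDl // !mulr_ge0.
pose c := (1 - rho) / 2.
have c0 : 0 < c by rewrite divr_gt0 // subr_gt0.
exists (c / D); first exact: divr_gt0.
move=> X' hX'; exists K, (rho + c).
have hc : c / D * (B * B * h * K) <= c.
  rewrite mulrAC ler_pdivrMr //; apply: ler_wpM2l; first exact: ltW.
  by rewrite lerDl.
split => //; first by rewrite addr_ge0 // ltW.
  by rewrite -subr_gt0 (_ : 1 - _ = c) // /c; field.
(* Expanding the first letter [i] of [w] gives [X_(v i)], to which the induction applies with the
   longer prefix, plus [e] times the product of [X_v] and [H], which is bounded with the estimate
   for the rest of [w] and the empty prefix. The prefix keeps [K] from being multiplied in at every
   unperturbed letter. *)
have M w : is_word d w -> forall v, is_word d v -> forall a,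
    `|cM s (sprod s (wprod s X v) (wprod s X' w)) a| <=
      K * rho ^+ size v * (rho + c) ^+ size w.
  elim: w => [|i w IH] hw v hv a.
    by rewrite expr0 mulr1 (meq_at (sprod1r _ hs)) hX.
  have [hi {}hw] := proj1 (Forall_cons_iff _ _ _) hw.
  rewrite [wprod _ _ _]/= -(meq_at (sprodA _ _ _ hs)) cM_sprod.
  have E : cM s (sprod s (wprod s X v) (X' i)) =1 (fun b => cM s (wprod s X (v ++ [:: i])) b
       + c / D * amul (sst s) (cM s (wprod s X v)) (cM s H) b).
    move=> b; rewrite cM_sprod (eq_amul (fun _ _ _ => erefl) (fun _ => erefl) (hX' i)).
    rewrite amulDr amulZr; congr (_ + _); rewrite -cM_sprod.
    apply/esym; rewrite (meq_at (wprod_cat _ _ _ hs)).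
    by apply: meq_at; apply: sprod_ext => //=; apply: sprod1r.
  rewrite (eq_amul (fun _ _ _ => erefl) E (fun _ => erefl)) amulDl amulZl.
  have hvi : is_word d (v ++ [:: i]) by apply/Forall_app; split => //; constructor.
  apply: le_trans (ler_normD _ _) _.
  rewrite exprS mulrCA mulrDl.
  apply: (@le_trans _ _ (K * rho ^+ (size v).+1 * (rho + c) ^+ size w
     + c / D * (B * (B * (K * rho ^+ size v) * h) * (K * (rho + c) ^+ size w)))).
    apply: lerD.
      by rewrite -cM_sprod; apply: le_trans (IH hw _ hvi a) _; rewrite size_cat addn1.
    rewrite normrM ger0_norm; last by rewrite divr_ge0 // ltW.
    apply: ler_wpM2l; first by rewrite divr_ge0 // ltW.
    apply: amul_bound.
    - by rewrite !mulr_ge0 // exprn_ge0.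
    - by rewrite mulr_ge0 // exprn_ge0 // addr_ge0 // ltW.
    - move=> b; apply: amul_bound => //; first by rewrite mulr_ge0 // exprn_ge0.
        exact: hX.
      by move=> a'; rewrite /h (bigD1 a') //= lerDl sumr_ge0.
    - move=> b; have := IH hw [::] (Forall_nil _) b.
      by rewrite (meq_at (sprod1l _ hs)) expr0 mulr1.
  rewrite exprS; set r := rho ^+ _; set q := (rho + c) ^+ _.
  have r0 : 0 <= r by rewrite exprn_ge0.
  have q0 : 0 <= q by rewrite exprn_ge0 // addr_ge0 // ltW.
  have -> : K * (rho * r) * q + c / D * (B * (B * (K * r) * h) * (K * q)) =
    rho * (K * r * q) + c / D * (B * B * h * K) * (K * r * q) by ring.
  by rewrite lerD2l; apply: ler_wpM2r => //; rewrite !mulr_ge0.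
move=> w hw a; have := M w hw [::] (Forall_nil _) a.
by rewrite (meq_at (sprod1l _ hs)) expr0 mulr1.
Qed.

(** * Direct sums of algebras *)

(** The same algebra on rows and columns. Such products preserve positivity ([pos_pres_sym]), so
    positivity of [f] can be used at them. *)
Definition sym n g u := mkGSP n n g u g u.

Lemma veq_sym n x y : veq n x y -> veq n y x.
Proof. by move=> h k hk; rewrite h. Qed.
Lemma veq_trans n x y z : veq n x y -> veq n y z -> veq n x z.
Proof. by move=> h1 h2 k hk; rewrite h1 ?h2. Qed.

Lemma is_gsp_sym n g u : is_ualg n g u -> is_gsp (sym n g u).
Proof. by []. Qed.

(** The coordinates from [o] to [o + N' - 1] form a direct factor: on them a product depends only on
    the coordinates of the factors in the same range. The arbitrary [F] puts this in the form in
    which it is applied to sums. *)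
Definition summand (N : nat) (g : nat -> nat -> nat -> Cplx) (u : nat -> Cplx)
    (o N' : nat) (g' : nat -> nat -> nat -> Cplx) (u' : nat -> Cplx) :=
  [/\ (o + N' <= N)%N,
      forall k (F : nat -> nat -> CC), (k < N')%N ->
        \sum_(i < N) \sum_(j < N) F i j * toC (g i j (o + k)%N) =
        \sum_(i < N') \sum_(j < N') F (o + i)%N (o + j)%N * toC (g' i j k) &
      forall k, (k < N')%N -> u (o + k)%N = u' k :> Cplx].

Definition shift o o' (G : Mat) : Mat := fun i j => G (o + i)%N (o' + j)%N.

(** Columns carry conjugated constants; the identity is applied to the conjugate of [F] and
    conjugated back. *)
Lemma summandJ N g u o N' g' u' k (F : nat -> nat -> CC) :
  summand N g u o N' g' u' -> (k < N')%N ->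
  \sum_(i < N) \sum_(j < N) F i j * (toC (g i j (o + k)%N))^* =
  \sum_(i < N') \sum_(j < N') F (o + i)%N (o + j)%N * (toC (g' i j k))^*.
Proof.
move=> [_ S _] hk; have := S k (fun i j => (F i j)^*) hk.
move/(congr1 Num.conj); rewrite !rmorph_sum.
under eq_bigr do rewrite rmorph_sum.
under [X in _ = X -> _]eq_bigr do rewrite rmorph_sum.
move=> E; transitivity (\sum_(i < N) \sum_(j < N) ((F i j)^* * toC (g i j (o + k)%N))^*).
  by do 2!apply: eq_bigr => ? _; rewrite rmorphM /= conjCK.
by rewrite E; do 2!apply: eq_bigr => ? _; rewrite rmorphM /= conjCK.
Qed.

Section Summand.
Variables (s s' : GSP) (o o' : nat).
Hypothesis hA : summand (gn s) (ga s) (gua s) o (gn s') (ga s') (gua s').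
Hypothesis hB : summand (gm s) (gb s) (gub s) o' (gm s') (gb s') (gub s').

Lemma sprod_summand X Y :
  meq (gn s') (gm s') (shift o o' (sprod s X Y)) (sprod s' (shift o o' X) (shift o o' Y)).
Proof.
apply/meqP => p q; rewrite /shift !toC_sprod.
(* Summing over columns innermost leaves a double sum over rows of the shape required by [hA], with
   the column sum as [F]. *)
have R t (X' Y' : Mat) p' q' : \sum_(i < gn t) \sum_(j < gm t) \sum_(k < gn t) \sum_(l < gm t)
    toC (X' i j) * toC (Y' k l) * (toC (ga t i k p') * (toC (gb t j l q'))^*) =
  \sum_(i < gn t) \sum_(k < gn t) (\sum_(j < gm t) \sum_(l < gm t)
     toC (X' i j) * toC (Y' k l) * (toC (gb t j l q'))^*) * toC (ga t i k p').
  apply: eq_bigr => i _; rewrite exchange_big /=; apply: eq_bigr => k _.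
  rewrite mulr_suml; apply: eq_bigr => j _; rewrite mulr_suml; apply: eq_bigr => l _.
  by ring.
rewrite (R s X Y) (R s' (shift o o' X) (shift o o' Y)).
case: (hA) => _ H _.
rewrite (H _ (fun i k => \sum_(j < gm s) \sum_(l < gm s)
     toC (X i j) * toC (Y k l) * (toC (gb s j l (o' + q)%N))^*)) //.
apply: eq_bigr => i _; apply: eq_bigr => k _; congr (_ * _).
by rewrite (summandJ (fun j l => toC (X (o + i)%N j) * toC (Y (o + k)%N l)) hB).
Qed.

Lemma wprod_summand X w :
  meq (gn s') (gm s') (shift o o' (wprod s X w)) (wprod s' (fun i => shift o o' (X i)) w).
Proof.
elim: w => [|i w IH] /=.
  case: hA => _ _ uA; case: hB => _ _ uB; apply/meqP => p q.
  by rewrite /shift /sident uA // uB.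
apply: meq_trans (sprod_summand _ _) _; exact: sprod_ext IH.
Qed.

End Summand.

Section DirectSum.
Variables (m n : nat) (b a : nat -> nat -> nat -> Cplx) (ub ua : nat -> Cplx).
Let g := dsum_mul m b a.
Let u := dsum_unit m ub ua.

Let ltbT (i : 'I_m) : Nat.ltb i m = true.
Proof. by apply/Nat.ltb_lt/ssrnat.ltP. Qed.
Let ltbF i : Nat.ltb (m + i) m = false.
Proof. by apply/Nat.ltb_ge/ssrnat.leP; rewrite leq_addr. Qed.
Let subm i : Nat.sub (m + i) m = i.
Proof. by rewrite minusE addKn. Qed.

Lemma dsum_summandl : summand (m + n) g u 0 m b ub.
Proof.
split; first by rewrite leq_addr.
  move=> k F hk; rewrite big_split_ord /= [X in _ + X]big1 ?addr0; last first.
    move=> i _; apply: big1 => j _; rewrite /g /dsum_mul ltbF add0n.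
    by rewrite (ltbT (Ordinal hk)); case: (Nat.ltb j m); rewrite mulr0.
  apply: eq_bigr => i _; rewrite big_split_ord /= [X in _ + X]big1 ?addr0.
    by apply: eq_bigr => j _; rewrite /g /dsum_mul !add0n !ltbT (ltbT (Ordinal hk)).
  by move=> j _; rewrite /g /dsum_mul ltbT ltbF mulr0.
by move=> k hk; rewrite /u /dsum_unit add0n (ltbT (Ordinal hk)).
Qed.

Lemma dsum_summandr : summand (m + n) g u m n a ua.
Proof.
split => //.
  move=> k F hk; rewrite big_split_ord /= [X in X + _]big1 ?add0r; last first.
    move=> i _; apply: big1 => j _; rewrite /g /dsum_mul ltbT ltbF.
    by case: (Nat.ltb j m); rewrite mulr0.
  apply: eq_bigr => i _; rewrite big_split_ord /= [X in X + _]big1 ?add0r.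
    by apply: eq_bigr => j _; rewrite /g /dsum_mul !ltbF !subm.
  by move=> j _; rewrite /g /dsum_mul ltbT ltbF mulr0.
by move=> k hk; rewrite /u /dsum_unit ltbF subm.
Qed.

Lemma vmul_summand N g0 u0 o N' g' u' x y : summand N g0 u0 o N' g' u' ->
  veq N' (fun k => vmul N g0 x y (o + k)%N) (vmul N' g' (fun k => x (o + k)%N) (fun k => y (o + k)%N)).
Proof.
move=> [hN H _] k /ssrnat.ltP hk; apply: toC_inj; rewrite !toC_Csum.
transitivity (\sum_(i < N) \sum_(j < N) toC (x i) * toC (y j) * toC (g0 i j (o + k)%N)).
  by apply: eq_bigr => i _; rewrite toC_Csum; apply: eq_bigr => j _; rewrite !toCM.
rewrite (H k (fun i j => toC (x i) * toC (y j))) //.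
by apply: eq_bigr => i _; rewrite toC_Csum; apply: eq_bigr => j _; rewrite !toCM.
Qed.

Lemma vmul_ext N g0 x x' y y' : veq N x x' -> veq N y y' ->
  veq N (vmul N g0 x y) (vmul N g0 x' y').
Proof.
move=> /veqP ex /veqP ey; apply/veqP => k; rewrite !toC_vmul.
exact: eq_amul.
Qed.

(** Both coordinate projections are multiplicative and together determine a vector ([glue]), so the
    axioms are inherited from the two summands. *)
Lemma is_ualg_dsum : is_ualg m b ub -> is_ualg n a ua -> is_ualg (m + n) g u.
Proof.
have glue x y : veq m x y -> veq n (fun k => x (m + k)%N) (fun k => y (m + k)%N) ->
    veq (m + n) x y.
  move=> /veqP h1 /veqP h2; apply/veqP => k; rewrite -(splitK k).
  by case: (fintype.split k) => i /=; [exact: (h1 i) | exact: (h2 i)].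
have A1 o N' g' u' : summand (m + n) g u o N' g' u' -> is_ualg N' g' u' -> forall x y z,
    veq N' (fun k => vmul (m + n) g (vmul (m + n) g x y) z (o + k)%N)
           (fun k => vmul (m + n) g x (vmul (m + n) g y z) (o + k)%N).
  move=> H [A _] x y z.
  apply: veq_trans (vmul_summand _ _ H) _; apply: veq_trans (vmul_ext _ (vmul_summand _ _ H) (fun _ _ => erefl)) _.
  apply: veq_trans (A _ _ _) _; apply: veq_sym; apply: veq_trans (vmul_summand _ _ H) _.
  exact: (vmul_ext _ (fun _ _ => erefl) (vmul_summand _ _ H)).
have U1 o N' g' u' : summand (m + n) g u o N' g' u' -> is_ualg N' g' u' -> forall x,
    veq N' (fun k => vmul (m + n) g u x (o + k)%N) (fun k => x (o + k)%N) /\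
    veq N' (fun k => vmul (m + n) g x u (o + k)%N) (fun k => x (o + k)%N).
  move=> H [_ [L R']] x; case: (H) => _ _ hu.
  have Eu : veq N' (fun k => u (o + k)%N) u' by move=> k /ssrnat.ltP hk; apply: hu.
  split; apply: veq_trans (vmul_summand _ _ H) _.
    exact: veq_trans (vmul_ext _ Eu (fun _ _ => erefl)) (L _).
  exact: veq_trans (vmul_ext _ (fun _ _ => erefl) Eu) (R' _).
move=> hb ha; split; last split.
- by move=> x y z; apply: glue; [exact: (A1 _ _ _ _ dsum_summandl) | exact: (A1 _ _ _ _ dsum_summandr)].
- move=> x; apply: glue; first exact: (proj1 (U1 _ _ _ _ dsum_summandl hb x)).
  exact: (proj1 (U1 _ _ _ _ dsum_summandr ha x)).
- move=> x; apply: glue; first exact: (proj2 (U1 _ _ _ _ dsum_summandl hb x)).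
  exact: (proj2 (U1 _ _ _ _ dsum_summandr ha x)).
Qed.

End DirectSum.

Lemma is_gsp_block s : is_gsp s -> is_gsp (block_gsp s).
Proof. by move=> [ha hb]; split; apply: is_ualg_dsum. Qed.

Lemma geo_ext d s X Y : geo d s X ->
  (forall w, is_word d w -> meq (gn s) (gm s) (wprod s X w) (wprod s Y w)) -> geo d s Y.
Proof.
move=> [K [r [K0 r0 r1 H]]] E; exists K, r; split=> // w hw a.
by rewrite -(meq_at (E w hw)) H.
Qed.

Lemma wprod_ext d s X Y w : (forall i, (i < d)%N -> meq (gn s) (gm s) (X i) (Y i)) ->
  is_word d w -> meq (gn s) (gm s) (wprod s X w) (wprod s Y w).
Proof.
move=> E; elim: w => [|i w IH] //= /Forall_cons_iff[/ssrnat.ltP hi hw].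
by apply: sprod_ext; [apply: E | apply: IH].
Qed.

(* 1 - (1 - r)(1 - r') dominates both rates: the order of CC is not total. *)
Lemma geo_block_sym d n g u Y (t := sym n g u) :
  (forall o o', (o == 0%N) || (o == n) -> (o' == 0%N) || (o' == n) ->
    geo d t (fun i => shift o o' (Y i))) ->
  geo d (block_gsp t) Y.
Proof.
pose P K (rho : CC) o o' := forall w, is_word d w -> forall a,
  `|cM t (wprod t (fun i => shift o o' (Y i)) w) a| <= K * rho ^+ size w.
move=> H.
have M K rho K' rho' o o' : 0 <= K -> 0 <= rho -> K <= K' -> rho <= rho' -> P K rho o o' -> P K' rho' o o'.
  move=> K0 r0 hK hr h w hw a; apply: le_trans (h w hw a) _.
  by apply: ler_pM => //; [rewrite exprn_ge0 | apply: lerXn2r => //; apply: le_trans hr].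
have rr (r r' : CC) : 0 <= r -> r < 1 -> 0 <= r' -> r' < 1 ->
   let q := 1 - (1 - r) * (1 - r') in [/\ 0 <= q, q < 1, r <= q & r' <= q].
  move=> r0 r1 r0' r1' q.
  have e1 : q - r = r' * (1 - r) by rewrite /q; ring.
  have e2 : q - r' = r * (1 - r') by rewrite /q; ring.
  have h1 : r <= q by rewrite -subr_ge0 e1 mulr_ge0 // subr_ge0 ltW.
  have h2 : r' <= q by rewrite -subr_ge0 e2 mulr_ge0 // subr_ge0 ltW.
  split => //; first exact: le_trans h1.
  by rewrite /q ltrBlDr ltrDl mulr_gt0 // subr_gt0.
have [K1 [r1 [k1 a1 b1 h1]]] := H 0%N 0%N isT isT.
have [K2 [r2 [k2 a2 b2 h2]]] := H 0%N n isT (introT orP (or_intror (eqxx _))).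
have [K3 [r3 [k3 a3 b3 h3]]] := H n 0%N (introT orP (or_intror (eqxx _))) isT.
have [K4 [r4 [k4 a4 b4 h4]]] := H n n (introT orP (or_intror (eqxx _))) (introT orP (or_intror (eqxx _))).
have [p0 p1 pa pb] := rr _ _ a1 b1 a2 b2.
have [q0 q1 qa qb] := rr _ _ a3 b3 a4 b4.
set p := 1 - _ * _ in p0 p1 pa pb; set q := 1 - _ * _ in q0 q1 qa qb.
have [t0 t1 ta tb] := rr _ _ p0 p1 q0 q1.
set rho := 1 - _ * _ in t0 t1 ta tb.
pose K := K1 + K2 + (K3 + K4).
have K0 : 0 <= K by rewrite !addr_ge0.
have KE : [/\ K1 <= K, K2 <= K, K3 <= K & K4 <= K].
  have l (x y : CC) : 0 <= y -> x <= x + y by move=> hy; rewrite lerDl.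
  have r (x y : CC) : 0 <= y -> x <= y + x by move=> hy; rewrite lerDr.
  split.
  - by apply: le_trans (l _ _ k2) (l _ _ _); rewrite addr_ge0.
  - by apply: le_trans (r _ _ k1) (l _ _ _); rewrite addr_ge0.
  - by apply: le_trans (l _ _ k4) (r _ _ _); rewrite addr_ge0.
  - by apply: le_trans (r _ _ k3) (r _ _ _); rewrite addr_ge0.
case: KE => e1 e2 e3 e4.
have P1 := M _ _ _ rho _ _ k1 a1 e1 (le_trans pa ta) h1.
have P2 := M _ _ _ rho _ _ k2 a2 e2 (le_trans pb ta) h2.
have P3 := M _ _ _ rho _ _ k3 a3 e3 (le_trans qa tb) h3.
have P4 := M _ _ _ rho _ _ k4 a4 e4 (le_trans qb tb) h4.
exists K, rho; split => // w hw [i j].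
have Sl : summand (n + n) (dsum_mul n g g) (dsum_unit n u u) 0 n g u := dsum_summandl _ _ _ _ _ _.
have Sr : summand (n + n) (dsum_mul n g g) (dsum_unit n u u) n n g u := dsum_summandr _ _ _ _ _ _.
(* A block of a word product is the word product of the blocks, so the four bounds apply
   entrywise. *)
have W o o' : summand (n + n) (dsum_mul n g g) (dsum_unit n u u) o n g u ->
    summand (n + n) (dsum_mul n g g) (dsum_unit n u u) o' n g u -> P K rho o o' ->
    forall i j : 'I_n, `|toC (wprod (block_gsp t) Y w (o + i)%N (o' + j)%N)| <= K * rho ^+ size w.
  move=> S S' h i' j'; have := h w hw (i', j').
  by rewrite -(meq_at (@wprod_summand (block_gsp t) t o o' S S' Y w)).
rewrite /cM /=; move: i j => /= i j; rewrite -(splitK i) -(splitK j).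
case: (fintype.split i) => i' /=; case: (fintype.split j) => j' /=.
- exact: (W 0%N 0%N Sl Sl P1 i' j').
- exact: (W 0%N n Sl Sr P2 i' j').
- exact: (W n 0%N Sr Sl P3 i' j').
- exact: (W n n Sr Sr P4 i' j').
Qed.

(** * Positive semidefinite matrices *)

Section QuadraticForm.
Variable C : numClosedFieldType.

Definition qf (I : finType) (y : I -> I -> C) (x : I -> C) : C :=
  \sum_i \sum_j (x i)^* * y i j * x j.

Lemma eq_qf (I : finType) (y y' : I -> I -> C) x x' :
  (forall i, y i =1 y' i) -> x =1 x' -> qf y x = qf y' x'.
Proof.
by move=> ey ex; apply: eq_bigr => i _; apply: eq_bigr => j _; rewrite ey !ex.
Qed.

(** Used with [c = 0] for diagonal entries, with fourth roots of unity for Hermitian symmetry and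
    polarization, and with [c = -1] for differences of states. *)
Lemma qf_two (I : finType) (y : I -> I -> C) (p q : I) (c : C) :
  qf y (fun k => (k == p)%:R + c * (k == q)%:R) =
  y p p + c * y p q + c^* * y q p + c^* * c * y q q.
Proof.
have S (F : I -> C) (r : I) : \sum_i F i * (i == r)%:R = F r by apply: sum_delta.
transitivity (\sum_i ((i == p)%:R + c^* * (i == q)%:R) * (y i p + c * y i q)).
  apply: eq_bigr => i _; rewrite rmorphD rmorphM !rmorph_nat.
  rewrite -(S (y i) p) -(S (y i) q) [c * \sum__ _]mulr_sumr -big_split mulr_sumr /=.
  by apply: eq_bigr => j _; ring.
transitivity (\sum_i (y i p + c * y i q) * (i == p)%:R +
              c^* * \sum_i (y i p + c * y i q) * (i == q)%:R).
  by rewrite mulr_sumr -big_split; apply: eq_bigr => i _ /=; ring.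
by rewrite !S; ring.
Qed.

(** Realness of the form at [e_i], [e_j], [e_i + e_j] and [e_i + 'i e_j] gives two linear relations
    between the off-diagonal entries and their conjugates, which combine to the claim. *)
Lemma psd_herm (I : finType) (y : I -> I -> C) : (forall x, 0 <= qf y x) ->
  forall i j, y j i = (y i j)^*.
Proof.
move=> h i j.
have D k : (y k k)^* = y k k.
  have := h (fun l => (l == k)%:R + 0 * (l == k)%:R).
  by rewrite qf_two conjC0 !mul0r !addr0 => /ger0_real /CrealP.
have e1 := h (fun k => (k == i)%:R + 1 * (k == j)%:R).
have e2 := h (fun k => (k == i)%:R + 'i * (k == j)%:R).
move: e1 e2; rewrite !qf_two => /ger0_real /CrealP e1 /ger0_real /CrealP e2.
move: e1 e2; rewrite !rmorphD !rmorphM /= !conjC1 !conjCi !rmorphN /= !conjCi !opprK !D.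
set a := y i j; set b := y j i => e1 e2.
have i2 : 'i * 'i = -1 :> C by rewrite -expr2 sqrCi.
have f1 : a^* + b^* = a + b.
  have : (a^* + b^*) - (a + b) = 0.
    by rewrite -[RHS](subrr (y i i + 1 * a + 1 * b + 1 * 1 * y j j)) -{1}e1; ring.
  by move/eqP; rewrite subr_eq0 => /eqP.
have f2 : b^* - a^* = a - b.
  have : 'i * ((b^* - a^*) - (a - b)) = 0.
    rewrite -[RHS](subrr (y i i + 'i * a + - 'i * b + - 'i * 'i * y j j)) -{1}e2; ring.
  by move/eqP; rewrite mulf_eq0 (negPf (neq0Ci _)) /= subr_eq0 => /eqP.
have : 2 * a^* = 2 * b.
  have -> : 2 * a^* = (a^* + b^*) - (b^* - a^*) by ring.
  by rewrite f1 f2; ring.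
by move/(mulfI (_ : 2 != 0)) => ->; rewrite // pnatr_eq0.
Qed.

(** Spectral theorem: [sp k] is an eigenvalue, nonnegative as the value of the form at the
    corresponding unit eigenvector. *)
Lemma psd_decomp n (y : 'I_n -> 'I_n -> C) : (forall x, 0 <= qf y x) ->
  exists (sp : 'I_n -> C) (P : 'I_n -> 'I_n -> C), (forall k, 0 <= sp k) /\
    forall i j, y i j = \sum_k sp k * (P k i)^* * P k j.
Proof.
move=> h; pose A := \matrix_(i < n, j < n) y i j.
have hA : A \is normalmx.
  apply: hermitian_normalmx; apply/is_hermitianmxP; rewrite expr0 scale1r.
  by apply/matrixP => i j; rewrite !mxE; apply: psd_herm.
have := orthomx_spectralP hA; set P := spectralmx A; set sp := spectral_diag A => E.
have Pu : P \is unitarymx := spectral_unitarymx A.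
have Ei := invmx_unitary Pu.
have Pn : P \in unitmx by apply: unitarymx_unit.
exists (fun k => sp 0 k), (fun k i => P k i); split.
  move=> k; have <- : (P *m A *m invmx P) k k = sp 0 k.
    by rewrite {1}E !mulmxA mulmxV // mul1mx -mulmxA mulmxV // mulmx1 mxE eqxx.
  have := h (fun j => (P k j)^*).
  rewrite (_ : qf _ _ = (P *m A *m invmx P) k k) // Ei !mxE /qf.
  rewrite exchange_big /=; apply: eq_bigr => j _.
  by rewrite !mxE mulr_suml; apply: eq_bigr => i _; rewrite !mxE conjCK.
move=> i j; have -> : y i j = A i j by rewrite mxE.
rewrite E Ei !mxE; apply: eq_bigr => k _; congr (_ * _).
rewrite mul_mx_diag !mxE mulrC //.
Qed.

(** Splitting [y] alone into rank-one terms writes the form of the Kronecker product as a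
    nonnegative combination of values of the form of [q]. *)
Lemma psd_tensor n (I : finType) (y : 'I_n -> 'I_n -> C) (q : I -> I -> C)
    (z : 'I_n -> I -> C) :
  (forall x, 0 <= qf y x) -> (forall x, 0 <= qf q x) ->
  0 <= \sum_i \sum_k \sum_j \sum_l (z i k)^* * (y i j * q k l) * z j l.
Proof.
move=> hy hq; have [sp [P [hs E]]] := psd_decomp hy.
rewrite (_ : \sum_i _ = \sum_r sp r * qf q (fun l => \sum_j P r j * z j l)).
  by apply: sumr_ge0 => r _; rewrite mulr_ge0.
transitivity (\sum_i \sum_k \sum_j \sum_l \sum_r
    sp r * ((P r i)^* * (z i k)^* * q k l * (P r j * z j l))).
  do 4!(apply: eq_bigr => ? _); rewrite E mulr_suml mulr_sumr mulr_suml.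
  by apply: eq_bigr => r _; ring.
transitivity (\sum_r \sum_k \sum_l \sum_i \sum_j
    sp r * ((P r i)^* * (z i k)^* * q k l * (P r j * z j l))); last first.
  apply: eq_bigr => r _; rewrite mulr_sumr; apply: eq_bigr => k _.
  rewrite mulr_sumr; apply: eq_bigr => l _.
  rewrite rmorph_sum mulr_suml mulr_suml mulr_sumr; apply: eq_bigr => i _.
  by rewrite mulr_sumr mulr_sumr; apply: eq_bigr => j _; rewrite rmorphM.
transitivity (\sum_k \sum_l \sum_i \sum_j \sum_r
    sp r * ((P r i)^* * (z i k)^* * q k l * (P r j * z j l))); last first.
  rewrite [RHS]exchange_big /=; apply: eq_bigr => k _.
  rewrite [RHS]exchange_big /=; apply: eq_bigr => l _.
  rewrite [RHS]exchange_big /=; apply: eq_bigr => i _.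
  by rewrite [RHS]exchange_big /=; apply: eq_bigr => j _.
rewrite exchange_big /=; apply: eq_bigr => k _.
transitivity (\sum_i \sum_l \sum_j \sum_r
    sp r * ((P r i)^* * (z i k)^* * q k l * (P r j * z j l))).
  by apply: eq_bigr => i _; rewrite exchange_big.
by rewrite exchange_big.
Qed.

End QuadraticForm.

Lemma psdP N Y : psd N Y <-> forall x : 'I_N -> CC, 0 <= qf (fun i j : 'I_N => toC (Y i j)) x.
Proof.
have E x : toC (qform N Y x) = qf (fun i j : 'I_N => toC (Y i j)) (fun i : 'I_N => toC (x i)).
  rewrite toC_Csum; apply: eq_bigr => i _; rewrite toC_Csum; apply: eq_bigr => j _.
  by rewrite !toCM toCJ mulrA.
split.
  move=> h x; pose x' k := if insub k is Some i then ofC (x i) else Defs.C0.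
  have /toC_ge0 := h x'; rewrite E.
  rewrite (@eq_qf _ _ _ (fun i j : 'I_N => toC (Y i j)) _ x) // => i.
  by rewrite /x' valK ofCK.
by move=> h x; apply/toC_ge0; rewrite E.
Qed.

(** With the same algebra on both sides, the product is the compression of the Kronecker product of
    [P] and [Q] by the multiplication map; [z] is the adjoint of that map applied to [x]. *)
Lemma pos_pres_sym n g u : pos_pres (sym n g u).
Proof.
split => // P Q /=; rewrite -/(psd n P) => /psdP hP /psdP hQ; apply/psdP => x.
pose z (j l : 'I_n) := \sum_q (toC (g j l (q : 'I_n)))^* * x q.
have := psd_tensor z hP hQ; congr (0 <= _); rewrite /qf.
transitivity (\sum_p \sum_q \sum_(i < n) \sum_(j < n) \sum_(k < n) \sum_(l < n)
  (x p)^* * x q * (toC (P i j) * toC (Q k l) * (toC (g i k (p : 'I_n)) * (toC (g j l (q : 'I_n)))^*)));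
  last first.
  apply: eq_bigr => p _; apply: eq_bigr => q _; rewrite toC_sprod /=.
  rewrite mulr_sumr mulr_suml; apply: eq_bigr => i _.
  rewrite mulr_sumr mulr_suml; apply: eq_bigr => j _.
  rewrite mulr_sumr mulr_suml; apply: eq_bigr => k _.
  rewrite mulr_sumr mulr_suml; apply: eq_bigr => l _; by ring.
transitivity (\sum_(i < n) \sum_(j < n) \sum_(k < n) \sum_(l < n) \sum_p \sum_q
  (x p)^* * x q * (toC (P i j) * toC (Q k l) * (toC (g i k (p : 'I_n)) * (toC (g j l (q : 'I_n)))^*))).
  apply: eq_bigr => i _; rewrite exchange_big /=; apply: eq_bigr => j _.
  apply: eq_bigr => k _; apply: eq_bigr => l _.
  rewrite /z rmorph_sum !mulr_suml; apply: eq_bigr => p _.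
  rewrite mulr_sumr; apply: eq_bigr => q _; rewrite rmorphM /= conjCK; by ring.
have X6 (F : 'I_n -> 'I_n -> 'I_n -> 'I_n -> 'I_n -> CC) :
    \sum_i \sum_j \sum_k \sum_l \sum_p F i j k l p = \sum_p \sum_i \sum_j \sum_k \sum_l F i j k l p.
  rewrite [RHS]exchange_big /=; apply: eq_bigr => i _.
  rewrite [RHS]exchange_big /=; apply: eq_bigr => j _.
  rewrite [RHS]exchange_big /=; apply: eq_bigr => k _.
  by rewrite [RHS]exchange_big.
by rewrite X6; apply: eq_bigr => p _; rewrite X6.
Qed.

Lemma psd_sident n g u : psd n (sident (sym n g u)).
Proof.
apply/psdP => x; rewrite /qf.
rewrite (_ : \sum_i _ = `|\sum_(j < n) (toC (u j))^* * x j| ^+ 2) ?exprn_ge0 //.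
rewrite normCKC rmorph_sum mulr_suml; apply: eq_bigr => i _.
rewrite mulr_sumr; apply: eq_bigr => j _.
by rewrite /sident toCM toCJ rmorphM /= conjCK; ring.
Qed.

Lemma psd_wprod d n g u X w : (forall i, (i < d)%N -> psd n (X i)) -> is_word d w ->
  psd n (wprod (sym n g u) X w).
Proof.
move=> h; elim: w => [|i w IH] /=; first by move=> _; apply: psd_sident.
move=> /Forall_cons_iff[/ssrnat.ltP hi hw].
by apply: (proj2 (pos_pres_sym n g u)); [apply: h | apply: IH].
Qed.

Lemma pdP N Y : pd N Y <-> forall x : 'I_N -> CC, (exists i, x i != 0) ->
  0 < qf (fun i j : 'I_N => toC (Y i j)) x.
Proof.
have E x : toC (qform N Y x) = qf (fun i j : 'I_N => toC (Y i j)) (fun i : 'I_N => toC (x i)).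
  rewrite toC_Csum; apply: eq_bigr => i _; rewrite toC_Csum; apply: eq_bigr => j _.
  by rewrite !toCM toCJ mulrA.
have G z : (0 < toC z) <-> (Cim z = R0 /\ Rlt R0 (Cre z)).
  rewrite ltcE /=; split; first by move=> /andP[/eqP h1 /RltP h2].
  by case=> h1 h2; apply/andP; split; [apply/eqP | apply/RltP].
split.
  move=> h x [i hi]; pose x' k := if insub k is Some i then ofC (x i) else Defs.C0.
  have /G : Cim (qform N Y x') = R0 /\ Rlt R0 (Cre (qform N Y x')).
    apply: h; exists i; split; first exact/ssrnat.ltP.
    rewrite /x' valK => e; move/eqP: hi; apply; rewrite -[x i]ofCK e toC0 //.
  rewrite E (@eq_qf _ _ _ (fun i j : 'I_N => toC (Y i j)) _ x) // => k.
  by rewrite /x' valK ofCK.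
move=> h x [i [/ssrnat.ltP hi nz]]; apply/G; rewrite E; apply: h.
exists (Ordinal hi); apply/eqP; rewrite -toC0 => e; exact: (nz (toC_inj e)).
Qed.

Lemma pd_psd N Y : pd N Y -> psd N Y.
Proof.
move=> /pdP h; apply/psdP => x.
have [/existsP hx|/existsPn hx] := boolP [exists i, x i != 0].
  exact/ltW/h.
rewrite /qf big1 // => i _; apply: big1 => j _.
by have := hx j; rewrite negbK => /eqP ->; rewrite mulr0.
Qed.

(* [[Z + eI, Z], [Z, Z + eI]] dominates eI. *)
Lemma pd_block n (Z Z' : Mat) (e : CC) : 0 < e -> psd n Z ->
  (forall i j : 'I_n, toC (Z' i j) = toC (Z i j) + e * (i == j)%:R) ->
  pd (n + n) (blockY n Z' Z Z').
Proof.
move=> e0 /psdP hZ hZ'; apply/pdP => x [k hk].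
have ltbT (i : 'I_n) : Nat.ltb i n = true by apply/Nat.ltb_lt/ssrnat.ltP.
have ltbF i : Nat.ltb (n + i) n = false by apply/Nat.ltb_ge/ssrnat.leP; rewrite leq_addr.
have subn' i : Nat.sub (n + i) n = i by rewrite minusE addKn.
pose a i := x (lshift n i); pose b i := x (rshift n i).
have -> : qf (fun i j : 'I_(n + n) => toC (blockY n Z' Z Z' i j)) x =
   qf (fun i j : 'I_n => toC (Z i j)) (fun i => a i + b i) + e * \sum_i `|x i| ^+ 2.
  have herm := psd_herm hZ.
  pose z (i j : 'I_n) := toC (Z i j).
  transitivity (\sum_i \sum_j ((a i)^* * (z i j + e * (i == j)%:R) * a j + (a i)^* * z i j * b j)
     + \sum_i \sum_j ((b i)^* * z i j * a j + (b i)^* * (z i j + e * (i == j)%:R) * b j)).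
    rewrite /qf big_split_ord; congr (_ + _); apply: eq_bigr => i _;
      rewrite big_split_ord big_split /=; congr (_ + _); apply: eq_bigr => j _;
      rewrite /blockY ?ltbT ?ltbF ?subn' ?hZ' ?toCJ -?herm //.
  have D (c : 'I_n -> CC) : \sum_i `|c i| ^+ 2 = \sum_i \sum_j (c i)^* * (i == j)%:R * c j.
    apply: eq_bigr => i _; rewrite (bigD1 i) //= eqxx mulr1 big1 ?addr0 ?normCKC //.
    by move=> j; rewrite eq_sym => /negPf ->; rewrite mulr0 mul0r.
  rewrite big_split_ord /= (D a) (D b) mulrDr !mulr_sumr /qf -!big_split /=.
  apply: eq_bigr => i _; rewrite !mulr_sumr -!big_split /=; apply: eq_bigr => j _.
  by rewrite rmorphD /z; ring.
rewrite ltr_wpDl // mulr_gt0 // (bigD1 k) //= ltr_wpDr ?exprn_gt0 ?normr_gt0 //.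
by apply: sumr_ge0 => i _; rewrite exprn_ge0.
Qed.

(** * Schur spectral contractions *)

Definition rC (x : R) : CC := toC (x, R0).

Lemma rC_le x y : rC x <= rC y <-> Rle x y.
Proof. by rewrite lecE /= eqxx /=; split => /RleP. Qed.
Lemma rC_lt x y : rC x < rC y <-> Rlt x y.
Proof. by rewrite ltcE /= eqxx /=; split => /RltP. Qed.
Lemma rCM x y : rC (Rmult x y) = rC x * rC y.
Proof. by rewrite /rC -toCM; congr toC; rewrite /Cmul /=; congr pair; Lra.lra. Qed.
Lemma rCX x k : rC (pow x k) = rC x ^+ k.
Proof. by elim: k => [|k IH] //; rewrite exprS -IH -rCM. Qed.
Lemma rCE (z : CC) : 0 <= z -> z = rC (Cre (ofC z)).
Proof.
case: z => a b; rewrite lecE /= => /andP[/eqP e _].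
by rewrite /rC /toC /= e.
Qed.

Lemma norm_toC z : `|toC z| = rC (Cabs z).
Proof.
have h : 0 <= rC (Cabs z) by apply/rC_le/Cabs_ge0.
apply/eqP; rewrite -(eqrXn2 (n := 2)) // normCK -toCJ -toCM expr2 -rCM.
rewrite /Cabs sqrt_sqrt; last by case: z {h} => a b /=; apply: Rplus_le_le_0_compat; apply: Rle_0_sqr.
by apply/eqP; congr toC; case: z {h} => a b; rewrite /Cmul /Cconj /=; congr pair; Lra.lra.
Qed.

Lemma geo_of_jsr d n g u Y : jsr_lt1 (sym n g u) d Y -> geo d (sym n g u) Y.
Proof.
move=> [L [L1 cv]].
have [C [r [C0 [[r0 r1] H]]]] := root_limit_geometric _ _ (maxnorm_ge0 (sym n g u) d Y) L1 cv.
exists (rC C), (rC r); split; [exact/rC_le | exact/rC_le | exact/rC_lt |].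
move=> w hw [p q]; rewrite /cM norm_toC -rCX -rCM; apply/rC_le => /=.
apply: Rle_trans (Cabs_le_mnorm _ _ _ _ _ _) _; [exact/ssrnat.ltP | exact/ssrnat.ltP|].
by apply: Rle_trans (H (size w)); apply: mnorm_le_maxnorm.
Qed.

Lemma jsr_of_geo d n g u Y (t := sym n g u) : is_ualg n g u -> geo d t Y -> jsr_lt1 t d Y.
Proof.
move=> hu [K [r [K0 r0 r1 H]]].
have ht : is_gsp t by [].
have KE := rCE K0; have rE := rCE r0.
set K' := Cre _ in KE; set r' := Cre _ in rE.
have BE := rCE (abound_ge0 (sst t)); set B := Cre _ in BE.
have B0 : Rle R0 B by apply/rC_le; rewrite -BE; apply: abound_ge0.
have hn := pos_INR n.
(* Submultiplicativity comes from cutting a word in two. [INR n * B] is the cost of the bilinear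
   bound and of passing from entries to the norm; adding 1 makes the constant positive. *)
apply: (@submultiplicative_root_limit (maxnorm t d Y) (Rplus (Rmult (INR n) B) R1) (Rmult (INR n) K') r').
- exact: maxnorm_ge0.
- by have := Rmult_le_pos _ _ hn B0; Lra.lra.
- move=> j k; set aj := maxnorm _ _ _ j; set ak := maxnorm _ _ _ k.
  have aj0 : Rle R0 aj := maxnorm_ge0 _ _ _ _.
  have ak0 : Rle R0 ak := maxnorm_ge0 _ _ _ _.
  apply: (Rle_trans _ (Rmult (INR n) (Rmult (Rmult B aj) ak))); last first.
    have := Rmult_le_pos _ _ aj0 ak0; Lra.lra.
  have P0 : Rle R0 (Rmult (Rmult B aj) ak) by do 2!apply: Rmult_le_pos => //.
  apply: maxnorm_le; first exact: Rmult_le_pos.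
  move=> w hw hl; apply: mnorm_le => // p q /ssrnat.ltP hp /ssrnat.ltP hq.
  have E : take j w ++ drop j w = w by apply: cat_take_drop.
  have /Forall_app [h1 h2] : is_word d (take j w ++ drop j w) by rewrite E.
  have s1 : size (take j w) = j by rewrite size_take (_ : size w = (j + k)%N) //; case: ltnP; lia.
  have s2 : size (drop j w) = k by rewrite size_drop (_ : size w = (j + k)%N) //; lia.
  apply/rC_le; rewrite -norm_toC !rCM -BE.
  have -> : toC (wprod t Y w p q) = cM t (wprod t Y w) (Ordinal hp, Ordinal hq) by [].
  rewrite -{1}E (meq_at (wprod_cat _ _ _ ht)) cM_sprod.
  have M (v : seq nat) (c : R) : is_word d v -> maxnorm t d Y (size v) = c ->
      forall a, `|cM t (wprod t Y v) a| <= rC c.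
    move=> hv <- [a b]; rewrite /cM norm_toC; apply/rC_le.
    apply: Rle_trans (mnorm_le_maxnorm _ _ _ _ hv).
    by apply: Cabs_le_mnorm; apply/ssrnat.ltP => /=.
  apply: amul_bound; [exact/rC_le | exact/rC_le | by apply: M => //; rewrite s1 | by apply: M => //; rewrite s2].
- by split; [apply/rC_le; rewrite -rE | apply/rC_lt; rewrite -rE].
- move=> k; rewrite Rmult_assoc.
  have P0 : Rle R0 (Rmult K' (pow r' k)).
    apply: Rmult_le_pos; first by apply/rC_le; rewrite -KE.
    by apply: pow_le; apply/rC_le; rewrite -rE.
  apply: maxnorm_le; first exact: Rmult_le_pos.
  move=> w hw hl; apply: mnorm_le => // p q /ssrnat.ltP hp /ssrnat.ltP hq.
  apply/rC_le; rewrite -norm_toC !rCM rCX -KE -rE -hl.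
  exact: (H w hw (Ordinal hp, Ordinal hq)).
Qed.

Section BlockEntries.
Variables (m n : nat) (A X B : Mat).
Let ltbT i : (i < m)%N -> Nat.ltb i m = true.
Proof. by move=> h; apply/Nat.ltb_lt/ssrnat.ltP. Qed.
Let ltbF i : Nat.ltb (m + i) m = false.
Proof. by apply/Nat.ltb_ge/ssrnat.leP; rewrite leq_addr. Qed.
Let subm i : Nat.sub (m + i) m = i.
Proof. by rewrite minusE addKn. Qed.

Lemma shift_blockY00 : meq m m (shift 0 0 (blockY m A X B)) A.
Proof.
move=> i j /ssrnat.ltP hi /ssrnat.ltP hj.
by rewrite /shift /blockY !add0n !ltbT.
Qed.
Lemma shift_blockY01 : meq m n (shift 0 m (blockY m A X B)) (fun i j => Cconj (X j i)).
Proof.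
move=> i j /ssrnat.ltP hi /ssrnat.ltP hj.
by rewrite /shift /blockY !add0n (ltbT hi) ltbF subm.
Qed.
Lemma shift_blockY10 : meq n m (shift m 0 (blockY m A X B)) X.
Proof.
move=> i j /ssrnat.ltP hi /ssrnat.ltP hj.
by rewrite /shift /blockY !add0n ltbF (ltbT hj) subm.
Qed.
Lemma shift_blockY11 : meq n n (shift m m (blockY m A X B)) B.
Proof.
move=> i j /ssrnat.ltP hi /ssrnat.ltP hj.
by rewrite /shift /blockY !ltbF !subm.
Qed.
End BlockEntries.

(** The witnesses are [Z + e I] on both diagonal blocks: the block matrix is positive definite by
    [pd_block], its off-diagonal blocks agree because [Z] is Hermitian, and its four blocks multiply
    separately. [geo_perturb] supplies an [e] for which the diagonal blocks still decay. Here [I] is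
    the identity matrix, in general not the unit of the product. *)
Lemma inCd_sym d n g u Z : is_ualg n g u -> (forall i, (i < d)%N -> psd n (Z i)) ->
  geo d (sym n g u) Z -> inCd d (sym n g u) Z.
Proof.
move=> hu hZ gZ; set t := sym n g u.
have [e e0 He] := geo_perturb (fun i j => ndelta i j) (is_gsp_sym hu) gZ.
pose Z' i : Mat := fun p q => ofC (toC (Z i p q) + e * (p == q)%:R).
have gZ' : geo d t Z'.
  by apply: He => i [p q]; rewrite /cM /Z' ofCK toC_ndelta.
split => //; exists Z', Z'; split.
  move=> i /ssrnat.ltP hi; apply: (@pd_block n _ _ e) => //; first exact: hZ.
  by move=> p q; rewrite /Z' ofCK.
have hb : is_ualg (n + n) (dsum_mul n g g) (dsum_unit n u u) by apply: is_ualg_dsum.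
apply: (jsr_of_geo hb); apply: (@geo_block_sym d n g u) => o o' ho ho'.
have herm i : (i < d)%N -> meq n n (fun p q => Cconj (Z i q p)) (Z i).
  move=> hi; apply/meqP => p q; rewrite toCJ.
  by have /psdP /psd_herm /(_ q p) -> := hZ i hi.
have T V W : geo d t V -> (forall i, (i < d)%N -> meq n n (W i) (V i)) -> geo d t W.
  move=> gV E; apply: geo_ext gV _ => w hw.
  by apply: (wprod_ext _ hw) => i hi; apply: meq_sym; apply: E.
have [->|n0] := eqVneq o 0%N; [|have {n0 ho} -> : o = n by case/orP: ho n0 => /eqP -> //; rewrite eqxx];
 (have [->|n0] := eqVneq o' 0%N; [|have {n0 ho'} -> : o' = n by case/orP: ho' n0 => /eqP -> //; rewrite eqxx]).
- by apply: T gZ' _ => i _; apply: shift_blockY00.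
- apply: T gZ _ => i hi; exact: meq_trans (@shift_blockY01 n n _ _ _) (herm i hi).
- by apply: T gZ _ => i _; apply: shift_blockY10.
- by apply: T gZ' _ => i _; apply: shift_blockY11.
Qed.

(** Passing to the lower-left corner is multiplicative for [block_gsp], whose product is of the form
    [sym]. Semidefiniteness and decay of [Y] are what [inCd_sym] asks of a tuple. *)
Lemma inCd_block d s X : inCd d s X -> exists Y,
  [/\ forall i, (i < d)%N -> psd (gm s + gn s) (Y i),
      geo d (block_gsp s) Y &
      forall w, is_word d w ->
        meq (gn s) (gm s) (shift (gm s) 0 (wprod (block_gsp s) Y w)) (wprod s X w)].
Proof.
move=> [hs [A [B [hp hj]]]]; exists (fun i => blockY (gm s) (A i) (X i) (B i)); split.
- by move=> i hi; apply/pd_psd/hp/ssrnat.ltP.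
- exact: geo_of_jsr hj.
- move=> w hw; apply: meq_trans (@wprod_summand (block_gsp s) s (gm s) 0 _ _ _ w) _.
  + exact: dsum_summandr.
  + exact: dsum_summandl.
  + by apply: (wprod_ext _ hw) => i _; apply: shift_blockY10.
Qed.

(** * Tensoring with matrix units *)

Section FiniteIndex.
Variable I : finType.

(** Algebras in the statement have bases numbered by naturals. Constructions are made over an
    arbitrary finite type [I] and transported along [enum_rank]; numbers out of range give the
    default 0. *)
Definition onat (i : nat) : option I :=
  omap (fun k : 'I_#|I| => enum_val k) (insub i).

Lemma onat_rank a : onat (enum_rank a) = Some a.
Proof. by rewrite /onat valK /= enum_rankK. Qed.

Definition natG (g : I -> I -> I -> CC) (i j k : nat) : Cplx :=
  if (onat i, onat j, onat k) is (Some a, Some b, Some c) then ofC (g a b c) else Defs.C0.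
Definition natU (u : I -> CC) (i : nat) : Cplx :=
  if onat i is Some a then ofC (u a) else Defs.C0.
Definition natM (z : I -> I -> CC) (i j : nat) : Cplx :=
  if (onat i, onat j) is (Some a, Some b) then ofC (z a b) else Defs.C0.
Definition mI (X : Mat) (a b : I) : CC := toC (X (enum_rank a) (enum_rank b)).

Lemma toC_natG g a b c :
  toC (natG g (enum_rank a) (enum_rank b) (enum_rank c)) = g a b c.
Proof. by rewrite /natG !onat_rank ofCK. Qed.
Lemma toC_natU u a : toC (natU u (enum_rank a)) = u a.
Proof. by rewrite /natU !onat_rank ofCK. Qed.
Lemma mI_natM z a b : mI (natM z) a b = z a b.
Proof. by rewrite /mI /natM !onat_rank ofCK. Qed.

Lemma sum_rank (F : 'I_#|I| -> CC) : \sum_i F i = \sum_a F (enum_rank a).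
Proof. exact: (reindex _ (onW_bij _ (@enum_rank_bij I))). Qed.

Lemma ord_rank (i : 'I_#|I|) : exists a, i = enum_rank a.
Proof. by exists (enum_val i); rewrite enum_valK. Qed.

Lemma is_ualg_nat g u : aassoc g -> aunit g u -> is_ualg #|I| (natG g) (natU u).
Proof.
move=> gA [ul ur]; apply/is_ualgP; split; last split.
- move=> i j l p; case: (ord_rank i) (ord_rank j) (ord_rank l) (ord_rank p)
    => [a ->] [b ->] [c ->] [e ->].
  rewrite !sum_rank /cst; under eq_bigr do rewrite !toC_natG.
  by under [RHS]eq_bigr do rewrite !toC_natG.
- move=> j k; case: (ord_rank j) (ord_rank k) => [a ->] [b ->].
  rewrite sum_rank /cst; under eq_bigr do rewrite toC_natG toC_natU.
  by rewrite ul (inj_eq enum_rank_inj).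
- move=> j k; case: (ord_rank j) (ord_rank k) => [a ->] [b ->].
  rewrite sum_rank /cst; under eq_bigr do rewrite toC_natG toC_natU.
  by rewrite ur (inj_eq enum_rank_inj).
Qed.

Lemma mI_sprod g u X Y a b : mI (sprod (sym #|I| (natG g) u) X Y) a b =
  \sum_a1 \sum_b1 \sum_a2 \sum_b2
     mI X a1 b1 * mI Y a2 b2 * (g a1 a2 a * (g b1 b2 b)^*).
Proof.
rewrite /mI toC_sprod /= sum_rank; apply: eq_bigr => a1 _.
rewrite sum_rank; apply: eq_bigr => b1 _; rewrite sum_rank; apply: eq_bigr => a2 _.
by rewrite sum_rank; apply: eq_bigr => b2 _; rewrite !toC_natG.
Qed.

Lemma psd_mI X : psd #|I| X <-> forall x, 0 <= qf (mI X) x.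
Proof.
have E x : qf (fun i j : 'I_#|I| => toC (X i j)) x = qf (mI X) (fun a => x (enum_rank a)).
  by rewrite /qf sum_rank; apply: eq_bigr => a _; rewrite sum_rank.
split; last by move=> h; apply/psdP => x; rewrite E.
move/psdP => h x; have := h (fun i => x (enum_val i)).
by rewrite E (@eq_qf _ _ _ (mI X) _ x) // => a; rewrite enum_rankK.
Qed.

Lemma geo_mI d g u X (K r : CC) : 0 <= K -> 0 <= r -> r < 1 ->
  (forall w, is_word d w -> forall a b,
     `|mI (wprod (sym #|I| g u) X w) a b| <= K * r ^+ size w) ->
  geo d (sym #|I| g u) X.
Proof.
move=> K0 r0 r1 H; exists K, r; split => // w hw [i j].
by case: (ord_rank i) (ord_rank j) => [a ->] [b ->]; apply: H.
Qed.

End FiniteIndex.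

Lemma sum_only (I : finType) (k : I) (F : I -> CC) :
  (forall i, i != k -> F i = 0) -> \sum_i F i = F k.
Proof. by move=> h; rewrite (bigD1 k) //= big1 ?addr0. Qed.

Lemma sum2_prod (K M : finType) (A : K -> K -> CC) (B : M -> M -> CC) :
  \sum_(a : K * M) \sum_(b : K * M) A a.1 b.1 * B a.2 b.2 =
  (\sum_a \sum_b A a b) * (\sum_a \sum_b B a b).
Proof.
rewrite -(sum_prod (fun a => \sum_b A a b) (fun a => \sum_b B a b)).
by apply: eq_bigr => a _; apply: sum_prod.
Qed.

Lemma sum4_prod (K M : finType) (F : K -> K -> K -> K -> CC) (H : M -> M -> M -> M -> CC) :
  \sum_(a : K * M) \sum_(b : K * M) \sum_(c : K * M) \sum_(e : K * M)
    F a.1 b.1 c.1 e.1 * H a.2 b.2 c.2 e.2 =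
  (\sum_a \sum_b \sum_c \sum_e F a b c e) * (\sum_a \sum_b \sum_c \sum_e H a b c e).
Proof.
have S3 (A : K -> K -> K -> CC) (B : M -> M -> M -> CC) :
  \sum_(a : K * M) \sum_(b : K * M) \sum_(c : K * M) A a.1 b.1 c.1 * B a.2 b.2 c.2 =
  (\sum_a \sum_b \sum_c A a b c) * (\sum_a \sum_b \sum_c B a b c).
  rewrite -(sum_prod (fun a => \sum_b \sum_c A a b c) (fun a => \sum_b \sum_c B a b c)).
  by apply: eq_bigr => a _; apply: sum2_prod.
rewrite -(sum_prod (fun a => \sum_b \sum_c \sum_e F a b c e)
  (fun a => \sum_b \sum_c \sum_e H a b c e)).
by apply: eq_bigr => a _; apply: S3.
Qed.

(* Pairs [(e, e')] in [J * J] index the matrix units of M_J; the tensor factor of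
   letter [i] is a Schur kernel [W i] on the transitions [e -> sg i e]. *)
Section Automaton.
Variables (n : nat) (g0 : nat -> nat -> nat -> Cplx) (u0 : nat -> Cplx).
Variables (J : finType) (Y : nat -> Mat).
Variables (sg : nat -> J -> J) (W : nat -> J -> J -> CC).

Definition aut_index := ('I_n * (J * J))%type.
Definition aut_gsp : GSP :=
  sym #|{: aut_index}| (@natG aut_index (atens (@cst n g0) (@amx CC J)))
    (@natU aut_index (fun a => toC (u0 a.1) * (a.2.1 == a.2.2)%:R)).

(** Supported on the graph of [s]: the entry at row [(e, s e)] and column [(g, s g)] is [w e g].
    Graphs compose under the multiplication of matrix units, so word products keep this shape. *)
Definition trans (s : J -> J) (w : J -> J -> CC) (x y : J * J) : CC :=
  w x.1 y.1 * ((x.2 == s x.1)%:R * (y.2 == s y.1)%:R).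

Definition aut_mat (i : nat) : Mat := @natM aut_index (fun a b =>
  toC (Y i a.1 b.1) * trans (sg i) (W i) a.2 b.2).

Fixpoint run (w : seq nat) (e : J) : J := if w is i :: w' then run w' (sg i e) else e.
Fixpoint weight (w : seq nat) (e g : J) : CC :=
  if w is i :: w' then W i e g * weight w' (sg i e) (sg i g) else 1.

Lemma is_ualg_aut : is_ualg n g0 u0 -> is_ualg (gn aut_gsp) (ga aut_gsp) (gua aut_gsp).
Proof.
move=> /is_ualgP[gA gu]; apply: is_ualg_nat; first exact: (atens_assoc gA (@amx_assoc _ J)).
exact: (atens_unit gu (@amx_unit _ J)).
Qed.

(** Multiplication of matrix units matches the end state of the first factor with the start state of
    the second, so a single term survives, for rows and columns alike. *)
Lemma trans_comp i w x y :
  \sum_x1 \sum_y1 \sum_x2 \sum_y2 trans (sg i) (W i) x1 y1 * trans (run w) (weight w) x2 y2 *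
     (amx CC x1 x2 x * (amx CC y1 y2 y)^*) =
  trans (run (i :: w)) (weight (i :: w)) x y.
Proof.
rewrite (@sum_only _ (x.1, sg i x.1)); last first.
  move=> [a b] ne; do 3!(apply: big1 => ? _); rewrite /trans /amx /=.
  have [e|_] := eqVneq b (sg i a); last by rewrite /= ?andbF !(mul0r, mulr0).
  have [ea|_] := eqVneq x.1 a; last by rewrite /= ?andbF !(mul0r, mulr0).
  by rewrite e -ea eqxx in ne.
rewrite (@sum_only _ (y.1, sg i y.1)); last first.
  move=> [a b] ne; do 2!(apply: big1 => ? _); rewrite /trans /amx /=.
  have [e|_] := eqVneq b (sg i a); last by rewrite /= ?andbF !(mul0r, mulr0).
  have [ea|_] := eqVneq y.1 a; last by rewrite /= ?andbF ?rmorph0 !(mul0r, mulr0).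
  by rewrite e -ea eqxx in ne.
rewrite (@sum_only _ (sg i x.1, x.2)); last first.
  move=> [a b] ne; apply: big1 => ? _; rewrite /trans /amx /= eqxx /=.
  have [e|_] := eqVneq (sg i x.1) a; last by rewrite /= ?andbF !(mul0r, mulr0).
  have [ea|_] := eqVneq x.2 b; last by rewrite /= ?andbF !(mul0r, mulr0).
  by rewrite -e -ea eqxx in ne.
rewrite (@sum_only _ (sg i y.1, y.2)); last first.
  move=> [a b] ne; rewrite /trans /amx /= eqxx /=.
  have [e|_] := eqVneq (sg i y.1) a; last by rewrite /= ?andbF ?rmorph0 !(mul0r, mulr0).
  have [ea|_] := eqVneq y.2 b; last by rewrite /= ?andbF ?rmorph0 !(mul0r, mulr0).
  by rewrite -e -ea eqxx in ne.
by rewrite /trans /amx /= !eqxx rmorph1; ring.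
Qed.

Lemma mI_aut_wprod w (a b : aut_index) : mI (wprod aut_gsp aut_mat w) a b =
  toC (wprod (sym n g0 u0) Y w a.1 b.1) * trans (run w) (weight w) a.2 b.2.
Proof.
elim: w a b => [|i w IH] a b /=.
  rewrite /mI /sident toCM toCJ !toC_natU toCM toCJ rmorphM rmorph_nat /trans /=.
  rewrite (eq_sym a.2.2) (eq_sym b.2.2); ring.
rewrite mI_sprod -trans_comp toC_sprod /= -sum4_prod.
do 4!(apply: eq_bigr => ? _); rewrite IH mI_natM /atens /cst rmorphM; ring.
Qed.

(** The kernel is a nonnegative combination of two rank-one kernels, so the form becomes the same
    combination of values of the form of [Y i], at the vectors obtained by summing [xi r] over the
    states. *)
Lemma psd_aut i (tau : bool -> CC) (v : bool -> J -> bool) :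
  (forall r, 0 <= tau r) -> psd n (Y i) ->
  (forall e g, W i e g = \sum_r tau r * ((v r e)%:R * (v r g)%:R)) ->
  psd (gn aut_gsp) (aut_mat i).
Proof.
move=> ht /psdP hY hW; apply/psd_mI => x.
pose xi r (a : aut_index) : CC := (a.2.2 == sg i a.2.1)%:R * (v r a.2.1)%:R * x a.
rewrite (_ : qf _ _ = \sum_r tau r * qf (fun k l : 'I_n => toC (Y i k l))
   (fun k => \sum_m xi r (k, m))).
  by apply: sumr_ge0 => r _; rewrite mulr_ge0.
transitivity (\sum_r \sum_(a : aut_index) \sum_(b : aut_index)
   tau r * ((xi r a)^* * toC (Y i a.1 b.1) * xi r b)).
  rewrite exchange_big /=; apply: eq_bigr => a _; rewrite exchange_big /=.
  apply: eq_bigr => b _; rewrite mI_natM /trans hW mulr_suml mulr_sumr mulr_sumr mulr_suml.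
  by apply: eq_bigr => r _; rewrite /xi !rmorphM !rmorph_nat; ring.
apply: eq_bigr => r _; rewrite /qf mulr_sumr.
transitivity (\sum_(k < n) \sum_m \sum_(b : aut_index)
    tau r * ((xi r (k, m))^* * toC (Y i k b.1) * xi r b)).
  rewrite [RHS]pair_bigA /=. by apply: eq_bigr => -[k m] _.
apply: eq_bigr => k _.
transitivity (\sum_m \sum_(l < n) \sum_m' tau r * ((xi r (k, m))^* * toC (Y i k l) * xi r (l, m'))).
  by apply: eq_bigr => m _; rewrite pair_bigA /=; apply: eq_bigr => -[l m'] _.
rewrite exchange_big /= mulr_sumr; apply: eq_bigr => l _.
rewrite rmorph_sum !mulr_suml mulr_sumr; apply: eq_bigr => m _.
by rewrite mulr_sumr mulr_sumr.
Qed.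

Lemma weight_bound (t : CC) w e g :
  (forall i e g, `|W i e g| <= t) -> `|weight w e g| <= t ^+ size w.
Proof.
move=> h; elim: w e g => [|i w IH] e g /=; first by rewrite normr1 expr0.
by rewrite normrM exprS; apply: ler_pM.
Qed.

(** The end state is a function of the start state, so a vector that ignores end states sees only
    [weight]. *)
Lemma qf_aut w (lam : J -> CC) (h : 'I_n -> CC) :
  qf (@mI aut_index (wprod aut_gsp aut_mat w)) (fun a => h a.1 * lam a.2.1) =
  qf (fun k l : 'I_n => toC (wprod (sym n g0 u0) Y w k l)) h * qf (weight w) lam.
Proof.
transitivity (qf (fun k l : 'I_n => toC (wprod (sym n g0 u0) Y w k l)) h *
   \sum_(x : J * J) \sum_(y : J * J)
     (lam x.1)^* * trans (run w) (weight w) x y * lam y.1).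
  rewrite -sum2_prod; apply: eq_bigr => a _; apply: eq_bigr => b _.
  by rewrite mI_aut_wprod rmorphM; ring.
congr (_ * _).
transitivity (\sum_e \sum_e' \sum_g \sum_g' (lam e)^* * weight w e g * lam g *
    ((e' == run w e)%:R * (g' == run w g)%:R)).
  rewrite [RHS]pair_bigA /=; apply: eq_bigr => x _.
  rewrite [RHS]pair_bigA /=; apply: eq_bigr => y _; rewrite /trans. ring.
apply: eq_bigr => e _; rewrite (@sum_only _ (run w e)); last first.
  by move=> i /negPf ->; do 2!(apply: big1 => ? _); rewrite mul0r mulr0.
apply: eq_bigr => g _; rewrite (@sum_only _ (run w g)); last first.
  by move=> i /negPf ->; rewrite !mulr0.
by rewrite !eqxx !mulr1.
Qed.

(** The start states are fixed and the end states, which vary with [w], are summed out. Done for all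
    [p] and [q], this linear map sends words of the automaton to weighted words in [Y]. *)
Lemma aut_start w (p q : 'I_n) (x y : J) :
  \sum_(a : aut_index) \sum_(b : aut_index)
     ((a.1 == p) && (a.2.1 == x))%:R * ((b.1 == q) && (b.2.1 == y))%:R *
     mI (wprod aut_gsp aut_mat w) a b =
  toC (wprod (sym n g0 u0) Y w p q) * weight w x y.
Proof.
transitivity ((\sum_k \sum_l (k == p)%:R * (l == q)%:R * toC (wprod (sym n g0 u0) Y w k l))
   * \sum_(m : J * J) \sum_(m' : J * J)
     (m.1 == x)%:R * (m'.1 == y)%:R * trans (run w) (weight w) m m').
  rewrite -sum2_prod; apply: eq_bigr => a _; apply: eq_bigr => b _.
  by rewrite mI_aut_wprod -!mulnb !natrM; ring.
congr (_ * _).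
  rewrite (@sum_only _ p); last first.
    by move=> i /negPf ->; apply: big1 => ? _; rewrite !mul0r.
  rewrite (@sum_only _ q); last by move=> i /negPf ->; rewrite mulr0 mul0r.
  by rewrite !eqxx !mul1r.
rewrite (@sum_only _ (x, run w x)); last first.
  move=> [e e'] ne; apply: big1 => m' _; rewrite /trans /=.
  have [E|_] := eqVneq e x; last by rewrite !mul0r.
  have [E'|_] := eqVneq e' (run w e); last by rewrite !(mul0r, mulr0).
  by rewrite E' E eqxx in ne.
rewrite (@sum_only _ (y, run w y)); last first.
  move=> [e e'] ne; rewrite /trans /=.
  have [E|_] := eqVneq e y; last by rewrite !(mulr0, mul0r).
  have [E'|_] := eqVneq e' (run w e); last by rewrite !(mul0r, mulr0).
  by rewrite E' E eqxx in ne.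
by rewrite /trans /= !eqxx !mul1r !mulr1.
Qed.

Lemma geo_aut d (K r : CC) : 0 <= K -> 0 <= r -> r < 1 ->
  (forall w, is_word d w -> forall (k l : 'I_n) e g,
     `|toC (wprod (sym n g0 u0) Y w k l)| * `|weight w e g| <= K * r ^+ size w) ->
  geo d aut_gsp aut_mat.
Proof.
move=> K0 r0 r1 H; apply: geo_mI K0 r0 r1 _ => w hw a b.
rewrite mI_aut_wprod; apply: le_trans (H w hw a.1 b.1 a.2.1 b.2.1).
rewrite !normrM; apply: ler_wpM2l => //; rewrite -[leRHS]mulr1 ler_wpM2l //.
by do 2!case: eqP => _; rewrite ?normr1 ?normr0 ?mulr0 ?mulr1 ?ler01.
Qed.

End Automaton.

Section NcFunctional.
Variables (d : nat) (f : GSP -> (nat -> Mat) -> Mat).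
Hypothesis hf : nc_function d f.

(** A linear map given by a kernel reads only meaningful entries, so it respects [meq] and is linear
    on all matrices; only its values on words remain to be checked. *)
Definition lin_mat (I : finType) (K : nat -> nat -> I -> I -> CC) (G : Mat) : Mat :=
  fun p q => ofC (\sum_a \sum_b K p q a b * mI G a b).

Section Linear.
Variables (I : finType) (g : nat -> nat -> nat -> Cplx) (u : nat -> Cplx) (t : GSP).
Variables (X Y : nat -> Mat) (K : nat -> nat -> I -> I -> CC).
Let s := sym #|I| g u.
Hypothesis hX : inCd d s X.
Hypothesis hY : inCd d t Y.
Hypothesis hK : forall w, is_word d w -> forall (p : 'I_(gn t)) (q : 'I_(gm t)),
  \sum_a \sum_b K p q a b * mI (wprod s X w) a b = toC (wprod t Y w p q).

Let K_ext Z Z' : meq (gn s) (gm s) Z Z' -> meq (gn t) (gm t) (lin_mat K Z) (lin_mat K Z').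
Proof.
move=> /meqP E; apply/meqP => i j; rewrite /lin_mat !ofCK.
by do 2!(apply: eq_bigr => ? _); rewrite /mI E.
Qed.

Let K_add Z Z' :
  meq (gn t) (gm t) (lin_mat K (madd Z Z')) (madd (lin_mat K Z) (lin_mat K Z')).
Proof.
apply/meqP => i j; rewrite /lin_mat /madd toCD !ofCK -big_split /=.
apply: eq_bigr => a _; rewrite -big_split /=; apply: eq_bigr => b _.
by rewrite /mI toCD mulrDr.
Qed.

Let K_scale c Z : meq (gn t) (gm t) (lin_mat K (mscale c Z)) (mscale c (lin_mat K Z)).
Proof.
apply/meqP => i j; rewrite /lin_mat /mscale toCM !ofCK mulr_sumr.
apply: eq_bigr => a _; rewrite mulr_sumr; apply: eq_bigr => b _.
by rewrite /mI toCM mulrCA.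
Qed.

Let K_words w : is_word d w -> meq (gn t) (gm t) (lin_mat K (wprod s X w)) (wprod t Y w).
Proof. by move=> hw; apply/meqP => i j; rewrite /lin_mat ofCK hK. Qed.

Lemma nc_lin_mat : meq (gn t) (gm t) (f t Y) (lin_mat K (f s X)).
Proof.
apply: (proj2 hf _ _ _ _ _ hX hY); apply: is_hom_of_words => //; [by case: hX | by case: hY].
Qed.

Lemma nc_lin (p : 'I_(gn t)) (q : 'I_(gm t)) :
  toC (f t Y p q) = \sum_a \sum_b K p q a b * mI (f s X) a b.
Proof. by have /meqP -> := nc_lin_mat; rewrite /lin_mat ofCK. Qed.

(** One evaluation of [f] controls several others in this way: the polynomial [l] found at [X] is
    inherited by its homomorphic images. *)
Lemma nc_lincomb l : words_in d l -> meq (gn s) (gm s) (f s X) (lincomb s X l) ->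
  meq (gn t) (gm t) (f t Y) (lincomb t Y l).
Proof.
move=> hl E; apply: meq_trans nc_lin_mat _; apply: meq_trans (K_ext E) _.
by apply: (phi_lincomb K_ext K_add K_scale K_words).
Qed.

End Linear.

Lemma nc_block s X Y : inCd d s X -> inCd d (block_gsp s) Y ->
  (forall w, is_word d w ->
        meq (gn s) (gm s) (shift (gm s) 0 (wprod (block_gsp s) Y w)) (wprod s X w)) ->
  meq (gn s) (gm s) (f s X) (shift (gm s) 0 (f (block_gsp s) Y)).
Proof.
move=> hX hY hw; apply: (proj2 hf _ _ _ _ (shift (gm s) 0) hY hX).
apply: is_hom_of_words => //; [by case: hY | by case: hX | ].
move=> Z Z' E i j hi hj; apply: E; move: hi hj => /=; lia.
Qed.

End NcFunctional.

(** * The coefficients *)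

Lemma In_mem (T : eqType) (x : T) s : In x s <-> x \in s.
Proof.
elim: s => [|y s IH] //=; rewrite inE; split.
  by move=> [->|/IH ->]; rewrite ?eqxx ?orbT.
by move=> /orP[/eqP->|/IH]; [left | right].
Qed.

Definition wordb d (w : seq nat) := all (fun i => (i < d)%N) w.

Lemma is_wordP d w : is_word d w <-> wordb d w.
Proof.
elim: w => [|i w IH] /=; first by split => // _; constructor.
rewrite /is_word Forall_cons_iff -/(is_word d w) IH; split; first by move=> [/ssrnat.ltP -> ->].
by move=> /andP[/ssrnat.ltP ? ?].
Qed.

Lemma mem_words d k w : (w \in words d k) = wordb d w && (size w == k).
Proof.
apply/idP/andP => [/In_mem/in_words[/is_wordP -> <-] //|[/is_wordP hw /eqP hk]].
by apply/In_mem/in_words.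
Qed.

Lemma uniq_words d k : uniq (words d k).
Proof.
elim: k => [|k IH] //=.
have -> : flat_map (fun w => List.map (fun i => i :: w) (List.seq 0 d)) (words d k) =
    [seq i :: w | w <- words d k, i <- iota 0 d].
  have -> : forall m, List.seq m d = iota m d by elim: d {IH} => [|d IH] m //=; rewrite IH.
  by elim: (words d k) => [|w l IHl] //=; rewrite IHl.
apply: allpairs_uniq => //; first exact: iota_uniq.
by move=> [v i] [w j] _ _ /= [-> ->].
Qed.

Lemma sum_words_delta d M v (F : seq nat -> CC) : wordb d v ->
  \sum_(k < M) \sum_(w <- words d k) F w * (w == v)%:R = F v * (size v < M)%:R.
Proof.
move=> hv; have [hM|hM] := ltnP (size v) M.
  rewrite (@sum_only _ (Ordinal hM)) /=; last first.
    move=> k /eqP ne; rewrite big_seq big1 // => w; rewrite mem_words => /andP[_ /eqP sw].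
    have [E|_] := eqVneq w v; last by rewrite mulr0.
    by case: ne; apply: val_inj; rewrite /= -sw E.
  rewrite (bigD1_seq v) ?uniq_words //=; last by rewrite mem_words hv eqxx.
  by rewrite eqxx big1 ?addr0 // => w /negPf ->; rewrite mulr0.
rewrite mulr0 big1 // => k _; rewrite big_seq big1 // => w; rewrite mem_words => /andP[_ /eqP sw].
have [E|_] := eqVneq w v; last by rewrite mulr0.
by have := ltn_ord k; rewrite -sw E ltnNge hM.
Qed.

Lemma toC_psum d c s X K p q : toC (psum d c s X K p q) =
  \sum_(k < K.+1) \sum_(w <- words d k) toC (c w) * toC (wprod s X w p q).
Proof.
rewrite toC_Csum; apply: eq_bigr => k _.
by elim: (words d k) => [|w l IH]; rewrite ?big_nil // big_cons /= toCD toCM IH.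
Qed.

(* The free truncated model: a word is a state, letters are appended on the right, and
   words of length [M] or more are sent to the dead state [None]. *)
Section Model.
Variables (d M : nat).

Definition short_words : seq (seq nat) := flatten [seq words d k | k <- iota 0 M].

Lemma mem_short_words w : (w \in short_words) = wordb d w && (size w < M)%N.
Proof.
apply/flatten_mapP/andP => [[k]|[hw hs]].
  by rewrite mem_iota mem_words => /andP[_ hk] /andP[-> /eqP ->].
by exists (size w); rewrite ?mem_iota // mem_words hw eqxx.
Qed.

Definition state : finType := option (seq_sub short_words).
Definition st (w : seq nat) : state := insub w.
Definition append (i : nat) (e : state) : state :=
  if e is Some x then st (rcons (val x) i) else None.
Definition alive (e : state) : bool := isSome e.
Definition mW (i : nat) (e g : state) : CC := (alive (append i e) && alive (append i g))%:R.

Lemma append_st v i : append i (st v) = st (rcons v i).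
Proof.
rewrite /st; case: insubP => [x _ <- //|nv] /=.
rewrite insubF //; apply: contraNF nv; rewrite !mem_short_words /wordb all_rcons size_rcons.
by move=> /andP[/andP[_ ->] /ltnW ->].
Qed.

Lemma run_st w v : run append w (st v) = st (v ++ w).
Proof. by elim: w v => [|i w IH] v /=; rewrite ?cats0 // append_st IH cat_rcons. Qed.

Lemma run_None w : run append w None = None.
Proof. by elim: w. Qed.

Lemma alive_run w e : alive (run append w e) -> alive e.
Proof. by case: e => // ; rewrite run_None. Qed.

Lemma st_val (x : seq_sub short_words) : Some x = st (val x) :> state.
Proof. by rewrite /st valK. Qed.

Lemma run_long w e : (M <= size w)%N -> run append w e = None.
Proof.
case: e => [x|] hM; last exact: run_None.
rewrite st_val run_st /st insubF // mem_short_words size_cat.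
by rewrite andbC ltnNge (leq_trans hM) // leq_addl.
Qed.

(** The empty word has weight 1 even from the dead state, hence [nilp w]. For other words the end of
    the run decides, since a dead run never revives. *)
Lemma mweight w e g :
  weight append mW w e g = (nilp w || alive (run append w e) && alive (run append w g))%:R.
Proof.
elim: w e g => [|i w IH] e g //=; rewrite IH /mW -natrM mulnb; congr (nat_of_bool _)%:R.
case: w {IH} => [|j w] /=; first by rewrite andbT.
have E e' : alive (run append w (append j (append i e'))) = true -> alive (append i e') = true.
  by move/alive_run => h; apply: (@alive_run [:: j]).
case A: (alive (run _ _ (append j (append i e)))); last by rewrite andbF.
case B: (alive (run _ _ (append j (append i g)))); last by rewrite !andbF.
by rewrite (E _ A) (E _ B).
Qed.

(** The scalars, with every letter equal to 1: tensoring with them leaves only the automaton. *)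
Definition one_alg : nat -> nat -> nat -> Cplx := fun _ _ _ => Defs.C1.
Definition one_vec : nat -> Cplx := fun _ => Defs.C1.
Definition one_mat : nat -> Mat := fun _ _ _ => Defs.C1.

Lemma is_ualg_one : is_ualg 1 one_alg one_vec.
Proof.
apply/is_ualgP; split; first by move=> i j l p; rewrite !big_ord1.
by split => i k; rewrite big_ord1 /cst /one_vec /one_alg /= mulr1 !ord1 eqxx.
Qed.

Lemma wprod_one w (p q : 'I_1) : toC (wprod (sym 1 one_alg one_vec) one_mat w p q) = 1.
Proof.
elim: w p q => [|i w IH] p q /=; first by rewrite /sident toCM toCJ rmorph1 mulr1.
rewrite toC_sprod /= !big_ord1 (IH ord0 ord0).
by rewrite /one_alg /one_mat toC1 rmorph1 !mulr1.
Qed.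

Definition model_gsp : GSP := aut_gsp 1 one_alg one_vec state.
Definition model : nat -> Mat := aut_mat 1 one_mat append mW.

(** The matrix unit with row the empty word and column [w]; by [model_entry] the diagonal entry at
    this index detects the word [w]. *)
Definition word_index (w : seq nat) : aut_index 1 state := (ord0, (st [::], st w)).

Lemma psd_model i : psd (gn model_gsp) (model i).
Proof.
apply: (@psd_aut _ _ _ _ _ _ _ i (fun r => r%:R) (fun _ e => alive (append i e))).
- by move=> r; apply: ler0n.
- apply/psdP => x; rewrite /qf !big_ord1 mulr1 -normCKC; exact: exprn_ge0.
- by move=> e g; rewrite big_bool /= mul1r mul0r addr0 -natrM mulnb.
Qed.

Lemma inCd_model : inCd d model_gsp model.
Proof.
apply: inCd_sym; [exact: (is_ualg_aut _ is_ualg_one) | by move=> i _; apply: psd_model |].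
(* Words longer than [M] vanish, so the rate is a free choice; for the rate [1 / 2] the factor
   [2 ^+ M] covers the shorter words. *)
apply: (@geo_aut _ _ _ _ _ _ _ _ (2 ^+ M) 2^-1).
- by rewrite exprn_ge0.
- by rewrite invr_ge0.
- by rewrite invf_lt1 ?ltr1n.
- move=> w _ k l e g; rewrite wprod_one normr1 mul1r.
  have [hM|hM] := ltnP M (size w).
    rewrite mweight run_long ?(ltnW hM) //= orbF.
    have -> : nilp w = false by case: w hM.
    by rewrite normr0 mulr_ge0 // exprn_ge0 // invr_ge0.
  apply: (@le_trans _ _ 1).
    rewrite -(expr1n _ (size w)); apply: weight_bound => i e' g'.
    by rewrite /mW; case: (_ && _); rewrite ?normr1 ?normr0.
  by rewrite -(subnK hM) exprD -mulrA -exprMn divff ?pnatr_eq0 // expr1n mulr1 exprn_ege1 ?ler1n.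
Qed.

Lemma model_entry v w : wordb d v -> wordb d w -> (size v < M)%N ->
  mI (wprod model_gsp model w) (word_index v) (word_index v) = (v == w)%:R.
Proof.
move=> hv hw hs; rewrite mI_aut_wprod wprod_one mul1r /trans /=.
rewrite -natrM mulnb andbb run_st /= mweight run_st /= -natrM mulnb.
congr (nat_of_bool _)%:R.
have sv : st v != None.
  by rewrite /st; case: insubP => [x _ _ //|]; rewrite mem_short_words hv hs.
have [<-|ne] := eqVneq v w.
  by rewrite eqxx andbT andbb; case: (st v) sv => // x _; rewrite orbT.
suff -> : (st v == st w) = false by rewrite andbF.
apply/negP; move: sv; rewrite /st; case: insubP => // x _ xv _.
by case: insubP => // y _ yw /eqP [exy]; case/eqP: ne; rewrite -xv -yw exy.
Qed.

(** The empty word is excepted on account of [M = 0], where its product is still the unit. *)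
Lemma model_nil w : (M <= size w)%N -> w != [::] ->
  meq (gn model_gsp) (gm model_gsp) (wprod model_gsp model w) mzero.
Proof.
move=> hM nw; apply/meqP => i j.
case: (ord_rank i) (ord_rank j) => [a ->] [b ->].
rewrite -/(mI (wprod model_gsp model w) a b) mI_aut_wprod /trans mweight run_long //= orbF.
by case: w nw {hM} => //= i' w _; rewrite mul0r mulr0.
Qed.

End Model.

Section Coefficients.
Variables (d : nat) (f : GSP -> (nat -> Mat) -> Mat).
Hypothesis hf : nc_function d f.
Hypothesis hpos : nc_pos_pres d f.

Definition coefM (M : nat) (w : seq nat) : CC :=
  mI (f (model_gsp d M) (model d M)) (word_index d M w) (word_index d M w).

(** The model of level [(size w).+1] is the smallest in which [w] is alive; by [coefME] the larger
    ones give the same value. *)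
Definition coef (w : seq nat) : Cplx := ofC (coefM (size w).+1 w).

Lemma coefM_ge0 M w : 0 <= coefM M w.
Proof.
have /psd_mI h := hpos (inCd_model d M) (pos_pres_sym _ _ _) (fun i _ => psd_model d M i).
have := h (fun k => (k == word_index d M w)%:R + 0 * (k == word_index d M w)%:R).
by rewrite qf_two rmorph0 !mul0r !addr0.
Qed.

(** Sending a matrix [G] of the model to the sum of [G_(w,w) X^w] over short words is a
    homomorphism: by [model_entry] it takes short words to the right words, and long words vanish in
    [X]. *)
Lemma nilpotent_coefM M t X : inCd d t X ->
  (forall w, is_word d w -> (M <= size w)%N -> meq (gn t) (gm t) (wprod t X w) mzero) ->
  forall (p : 'I_(gn t)) (q : 'I_(gm t)), toC (f t X p q) =
    \sum_(k < M) \sum_(w <- words d k) coefM M w * toC (wprod t X w p q).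
Proof.
move=> hX hnil p q.
pose K p q a b := \sum_(k < M) \sum_(w <- words d k)
  toC (wprod t X w p q) * ((a == word_index d M w)%:R * (b == word_index d M w)%:R).
have KE G p' q' : \sum_a \sum_b K p' q' a b * mI G a b = \sum_(k < M) \sum_(w <- words d k)
   toC (wprod t X w p' q') * mI G (word_index d M w) (word_index d M w).
  transitivity (\sum_a \sum_(k < M) \sum_(w <- words d k) toC (wprod t X w p' q') *
       ((a == word_index d M w)%:R * mI G a (word_index d M w))).
    apply: eq_bigr => a _.
    transitivity (\sum_b \sum_(k < M) \sum_(w <- words d k) toC (wprod t X w p' q') *
       ((a == word_index d M w)%:R * (mI G a b * (b == word_index d M w)%:R))).
      apply: eq_bigr => b _; rewrite /K mulr_suml; apply: eq_bigr => k _.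
      by rewrite mulr_suml; apply: eq_bigr => w _; ring.
    rewrite exchange_big /=; apply: eq_bigr => k _; rewrite exchange_big /=.
    by apply: eq_bigr => w _; rewrite -!mulr_sumr sum_delta.
  rewrite exchange_big /=; apply: eq_bigr => k _; rewrite exchange_big /=.
  apply: eq_bigr => w _; rewrite -!mulr_sumr; congr (_ * _).
  rewrite -[RHS](sum_delta (fun a => mI G a (word_index d M w))).
  by apply: eq_bigr => a _; rewrite mulrC.
rewrite (nc_lin hf (inCd_model d M) hX (K := K)); last first.
  move=> w hw p' q'; rewrite KE; have /is_wordP hwb := hw.
  transitivity (\sum_(k < M) \sum_(v <- words d k) toC (wprod t X v p' q') * (v == w)%:R).
    apply: eq_bigr => k _; rewrite big_seq [RHS]big_seq; apply: eq_bigr => v.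
    rewrite mem_words => /andP[hv /eqP hs]; rewrite model_entry // hs; exact: ltn_ord.
  rewrite (@sum_words_delta d M w (fun v => toC (wprod t X v p' q'))) //.
  have [hM|hM] := ltnP (size w) M; first by rewrite mulr1.
  by rewrite mulr0; have /meqP -> := hnil w hw hM.
rewrite KE; apply: eq_bigr => k _; apply: eq_bigr => w _; exact: mulrC.
Qed.

(** The smaller model is nilpotent of level [M], so the expansion with the coefficients of level [M]
    applies to it; its diagonal entry at [w] compares the two. *)
Lemma coefME M w : wordb d w -> (size w < M)%N -> coefM M w = toC (coef w).
Proof.
move=> hw hM; rewrite /coef ofCK /coefM.
set m := (size w).+1; set a := word_index d m w.
have hnil v : is_word d v -> (M <= size v)%N ->
    meq (gn (model_gsp d m)) (gm (model_gsp d m)) (wprod (model_gsp d m) (model d m) v) mzero.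
  move=> _ hv; apply: model_nil; first exact: leq_trans hM hv.
  by case: v hv => //; rewrite leqn0 => /eqP E; rewrite E in hM.
rewrite [RHS](nilpotent_coefM (inCd_model d m) hnil (enum_rank a) (enum_rank a)).
transitivity (\sum_(k < M) \sum_(v <- words d k) coefM M v * (v == w)%:R).
  by rewrite (@sum_words_delta d M w (coefM M)) // hM mulr1.
apply: eq_bigr => k _; rewrite big_seq [RHS]big_seq; apply: eq_bigr => v.
rewrite mem_words => /andP[hv _]; congr (_ * _).
by rewrite -/(mI _ a a) model_entry // eq_sym.
Qed.

Lemma coef_ge0 w : 0 <= toC (coef w).
Proof. by rewrite ofCK coefM_ge0. Qed.

Lemma nilpotent_coef M t X : inCd d t X ->
  (forall w, is_word d w -> (M <= size w)%N -> meq (gn t) (gm t) (wprod t X w) mzero) ->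
  forall (p : 'I_(gn t)) (q : 'I_(gm t)), toC (f t X p q) =
    \sum_(k < M) \sum_(w <- words d k) toC (coef w) * toC (wprod t X w p q).
Proof.
move=> hX hnil p q; rewrite (nilpotent_coefM hX hnil); apply: eq_bigr => k _.
rewrite big_seq [RHS]big_seq; apply: eq_bigr => w; rewrite mem_words => /andP[hw /eqP hs].
by rewrite coefME // hs; apply: ltn_ord.
Qed.

End Coefficients.

(** * The remainder estimate *)

Section QfSum.
Variable C : numClosedFieldType.

Lemma qf_sum (I : finType) (T : Type) (r : seq T) (c : T -> C) (F : T -> I -> I -> C) h :
  qf (fun i j => \sum_(x <- r) c x * F x i j) h = \sum_(x <- r) c x * qf (F x) h.
Proof.
under [RHS]eq_bigr do rewrite /qf mulr_sumr.
rewrite exchange_big /=; apply: eq_bigr => i _.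
under [RHS]eq_bigr do rewrite mulr_sumr.
rewrite exchange_big /=; apply: eq_bigr => j _.
by rewrite mulr_sumr mulr_suml; apply: eq_bigr => x _; ring.
Qed.

Lemma qf_sub (I : finType) (y z : I -> I -> C) h :
  qf (fun i j => y i j - z i j) h = qf y h - qf z h.
Proof.
rewrite /qf -sumrB; apply: eq_bigr => i _; rewrite -sumrB; apply: eq_bigr => j _.
by ring.
Qed.

End QfSum.

Lemma wprod_scale n g u (T : CC) Y w (p q : 'I_n) :
  toC (wprod (sym n g u) (fun i => mscale (ofC T) (Y i)) w p q) =
  T ^+ size w * toC (wprod (sym n g u) Y w p q).
Proof.
elim: w p q => [|i w IH] p q; first by rewrite expr0 mul1r.
rewrite [wprod _ _ _]/= [wprod _ _ (i :: w)]/= !toC_sprod /= exprS mulr_sumr.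
apply: eq_bigr => a _; rewrite mulr_sumr; apply: eq_bigr => b _.
rewrite mulr_sumr; apply: eq_bigr => c _; rewrite mulr_sumr; apply: eq_bigr => e _.
by rewrite IH /mscale toCM ofCK; ring.
Qed.

Section Clock.
Variables (M : nat) (T : CC).

Definition tick (e : 'I_M.+1) : 'I_M.+1 := inord (minn e.+1 M).
Definition nilW (i : nat) (e g : 'I_M.+1) : CC := ((e < M)%N && (g < M)%N)%:R.
Definition nilS (i : nat) (e : 'I_M.+1) := tick e.

Lemma val_tick e : tick e = minn e.+1 M :> nat.
Proof. by rewrite inordK // ltnS geq_minr. Qed.

(* Starting at time 0, the four kinds of states carry after [m] steps the weights
   [m <= M] (kN), 1 (kB), T^(m - M) truncated (kA) and T^m (kC). *)
Definition kN := (false, false).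
Definition kB := (false, true).
Definition kA := (true, false).
Definition kC := (true, true).
Definition clock_state : finType := ((bool * bool) * 'I_M.+1)%type.

Definition w1 (e : clock_state) : bool :=
  match e with ((false, false), i) => (i < M)%N | _ => true end.
Definition w2 (e : clock_state) : bool :=
  match e with
  | ((true, true), _) => true
  | ((true, false), i) => (M <= i)%N
  | _ => false
  end.
Definition clockS (i : nat) (e : clock_state) : clock_state := (e.1, tick e.2).
(** The rank-one kernels of [w1] and [w2] with weights 1 and [T - 1], hence positive for [1 <= T]. A
    step contributes [T] where both vectors are on at both states, and 1 where only [w1] is. At time
    [M], [w2] switches on for kind [kA] and [w1] off for kind [kN]. *)
Definition clockW (i : nat) (e g : clock_state) : CC :=
  (w1 e && w1 g)%:R + (T - 1) * (w2 e && w2 g)%:R.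

Lemma run_clock w k e : run clockS w (k, e) = (k, run nilS w e).
Proof. by elim: w e => [|i w IH] e //=; rewrite IH. Qed.

Lemma run_nil w e : run nilS w e = minn (e + size w) M :> nat.
Proof.
elim: w e => [|i w IH] e /=; first by rewrite addn0; have := ltn_ord e; lia.
by rewrite IH /nilS val_tick; have := ltn_ord e; lia.
Qed.

Lemma weight_NN w e g : weight clockS clockW w (kN, e) (kN, g) = weight nilS nilW w e g.
Proof. by elim: w e g => [|i w IH] e g //=; rewrite IH /clockW /= mulr0 addr0. Qed.

(** Steps are allowed at the times 0 to [M - 1], hence [M] of them from time 0. *)
Lemma weight_nil w (e : 'I_M.+1) : weight nilS nilW w e e = (size w <= M - e)%N%:R.
Proof.
elim: w e => [|i w IH] e //=; rewrite IH /nilW /nilS val_tick andbb.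
rewrite -natrM mulnb; congr (nat_of_bool _)%:R; have := ltn_ord e; lia.
Qed.

Lemma weight_BB w e : weight clockS clockW w (kB, e) (kB, e) = 1.
Proof. by elim: w e => [|i w IH] e //=; rewrite IH /clockW /= mulr0 addr0 mulr1. Qed.
Lemma weight_AB w e : weight clockS clockW w (kA, e) (kB, e) = 1.
Proof. by elim: w e => [|i w IH] e //=; rewrite IH /clockW /= andbF mulr0 addr0 mulr1. Qed.
Lemma weight_BA w e : weight clockS clockW w (kB, e) (kA, e) = 1.
Proof. by elim: w e => [|i w IH] e //=; rewrite IH /clockW /= mulr0 addr0 mulr1. Qed.
Lemma weight_CC w e : weight clockS clockW w (kC, e) (kC, e) = T ^+ size w.
Proof.
by elim: w e => [|i w IH] e //=; rewrite IH /clockW /= exprS mulr1 addrC subrK.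
Qed.
Lemma weight_BN w e : weight clockS clockW w (kB, e) (kN, e) = (size w <= M - e)%N%:R.
Proof.
rewrite -weight_nil; elim: w e => [|i w IH] e //=.
by rewrite IH /clockW /nilW /= mulr0 addr0 andbb.
Qed.
Lemma weight_NB w e : weight clockS clockW w (kN, e) (kB, e) = (size w <= M - e)%N%:R.
Proof.
rewrite -weight_nil; elim: w e => [|i w IH] e //=.
by rewrite IH /clockW /nilW /= mulr0 addr0 andbT andbb.
Qed.
Lemma weight_AA w (e : 'I_M.+1) :
  weight clockS clockW w (kA, e) (kA, e) = T ^+ (size w - (M - e)).
Proof.
elim: w e => [|i w IH] e //=; rewrite IH /clockW /= andbb val_tick.
have he := ltn_ord e; have [hM|hM] := leqP M e.
  rewrite mulr1 addrC subrK -exprS; congr (_ ^+ _); lia.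
rewrite mulr0 addr0 mul1r; congr (_ ^+ _); lia.
Qed.

Hypothesis T1 : 1 <= T.

Lemma norm_clockW i e g : `|clockW i e g| <= T.
Proof.
have T0 : 0 <= T - 1 by rewrite subr_ge0.
rewrite ger0_norm; last by rewrite addr_ge0 ?mulr_ge0.
have -> : T = 1 + (T - 1) * 1 by ring.
by apply: lerD; [|apply: ler_wpM2l => //]; rewrite lern1 leq_b1.
Qed.

Lemma norm_nilW i e g : `|nilW i e g| <= 1.
Proof. by rewrite /nilW normr_nat lern1 leq_b1. Qed.

End Clock.

Section Remainder.
Variables (d : nat) (f : GSP -> (nat -> Mat) -> Mat).
Hypothesis hf : nc_function d f.
Hypothesis hpos : nc_pos_pres d f.
Variables (n : nat) (g : nat -> nat -> nat -> Cplx) (u : nat -> Cplx) (Y : nat -> Mat).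
Let t := sym n g u.
Hypothesis hu : is_ualg n g u.
Hypothesis hY : forall i, (i < d)%N -> psd n (Y i).
Variables K rho T : CC.
Hypothesis K0 : 0 <= K.
Hypothesis rho0 : 0 <= rho.
Hypothesis gY : forall w, is_word d w -> forall a, `|cM t (wprod t Y w) a| <= K * rho ^+ size w.
Hypothesis T1 : 1 <= T.
Hypothesis Trho : T * rho < 1.

Let T0 : 0 <= T. Proof. exact: le_trans T1. Qed.
Let Tr0 : 0 <= T * rho. Proof. exact: mulr_ge0. Qed.
Let rho1 : rho < 1.
Proof. by apply: le_lt_trans Trho; rewrite -{1}[rho]mul1r ler_wpM2r. Qed.

Let tY i := mscale (ofC T) (Y i).

Lemma inCd_base : inCd d t Y.
Proof. by apply: inCd_sym => //; exists K, rho. Qed.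

Lemma inCd_scale : inCd d t tY.
Proof.
apply: inCd_sym => //.
  move=> i hi; apply/psdP => x; have /psdP /(_ x) h := hY hi.
  rewrite (_ : qf _ _ = T * qf (fun k l : 'I_n => toC (Y i k l)) x) ?mulr_ge0 //.
  rewrite /qf mulr_sumr; apply: eq_bigr => k _; rewrite mulr_sumr; apply: eq_bigr => l _.
  by rewrite /tY /mscale toCM ofCK; ring.
exists K, (T * rho); split => // w hw [p q]; rewrite /cM wprod_scale normrM.
rewrite exprMn mulrCA ger0_norm ?exprn_ge0 //; apply: ler_wpM2l; first exact: exprn_ge0.
exact: (gY hw (p, q)).
Qed.

Variable M : nat.
Let Zs := aut_gsp n g u (clock_state M).
Let Z := aut_mat n Y (@clockS M) (@clockW M T).
Let Ns := aut_gsp n g u 'I_M.+1.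
Let N := aut_mat n Y (@nilS M) (@nilW M).

Let start (k : bool * bool) : clock_state M := (k, ord0 : 'I_M.+1).
Let wt := weight (@clockS M) (@clockW M T).

Let tail0 : 0 <= T - 1. Proof. by rewrite subr_ge0. Qed.

Let psd_Z i : (i < d)%N -> psd (gn Zs) (Z i).
Proof.
move=> hi; apply: (@psd_aut _ _ _ _ _ _ _ i (fun r : bool => if r then 1 else T - 1)
   (fun (r : bool) e => if r then w1 e else w2 e)); [by case | exact: hY |].
by move=> e e'; rewrite big_bool /= /clockW -!mulnb !natrM mul1r.
Qed.

Let psd_N i : (i < d)%N -> psd (gn Ns) (N i).
Proof.
move=> hi; apply: (@psd_aut _ _ _ _ _ _ _ i (fun r : bool => r%:R)
   (fun (r : bool) (e : 'I_M.+1) => (e < M)%N)); [by case | exact: hY |].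
by move=> e e'; rewrite big_bool /= /nilW -!mulnb !natrM mul1r mul0r addr0.
Qed.

(** Weights grow at most like [T ^+ size w], so the rate becomes [T * rho]; this is where [Trho]
    enters. *)
Lemma inCd_clock : inCd d Zs Z.
Proof.
apply: inCd_sym => //; first exact: is_ualg_aut.
apply: (geo_aut K0 Tr0 Trho) => w hw k l e e'.
rewrite exprMn mulrA mulrAC; apply: ler_pM => //; first exact: (gY hw (k, l)).
by apply: weight_bound => *; apply: norm_clockW.
Qed.

Lemma inCd_nil : inCd d Ns N.
Proof.
apply: inCd_sym => //; first exact: is_ualg_aut.
apply: (geo_aut K0 rho0 rho1) => w hw k l e e'.
rewrite -[leRHS]mulr1; apply: ler_pM => //; first exact: (gY hw (k, l)).
by rewrite -(expr1n CC (size w)); apply: weight_bound => *; apply: norm_nilW.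
Qed.

Section Expansion.
(** A polynomial for [f Z], fixed for all the evaluations that follow. *)
Variable l : seq (seq nat * Cplx).
Hypothesis hl : words_in d l.
Hypothesis El : meq (gn Zs) (gm Zs) (f Zs Z) (lincomb Zs Z l).

(** Fixing the start states [x] and [y] maps [Z] to a reweighted [Y]; the kinds [kB] and [kC] yield
    [Y] and [T Y]. *)
Lemma start_lincomb Y2 x y : inCd d t Y2 ->
  (forall w (p q : 'I_n), toC (wprod t Y2 w p q) =
     toC (wprod t Y w p q) * weight (@clockS M) (@clockW M T) w x y) ->
  meq n n (f t Y2) (lincomb t Y2 l).
Proof.
move=> hY2 hw.
pose F p q (a b : aut_index n (clock_state M)) : CC :=
  ((nat_of_ord a.1 == p) && (a.2.1 == x))%:R * ((nat_of_ord b.1 == q) && (b.2.1 == y))%:R.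
apply: (nc_lincomb hf inCd_clock hY2 (K := F)) => // w _ p q.
by rewrite hw -(aut_start g u Y (@clockS M) (@clockW M T) w p q x y).
Qed.

Definition emb (a : aut_index n 'I_M.+1) : aut_index n (clock_state M) :=
  (a.1, ((kN, a.2.1), (kN, a.2.2))).

(** The kind of a state never changes along a run, so restricting to the entries of kind [kN] maps
    the words in [Z] to those in [N]. *)
Lemma nil_lincomb : meq (gn Ns) (gm Ns) (f Ns N) (lincomb Ns N l).
Proof.
pose F p q a b : CC :=
  (omap emb (@onat (aut_index n 'I_M.+1) p) == Some a)%:R *
  (omap emb (@onat (aut_index n 'I_M.+1) q) == Some b)%:R.
apply: (nc_lincomb hf inCd_clock inCd_nil (K := F)) => // w _ p q.
case: (ord_rank p) (ord_rank q) => [a ->] [b ->].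
rewrite /F !onat_rank /= (@sum_only _ (emb a)); last first.
  move=> i ne; apply: big1 => j _; rewrite (_ : (_ == Some i) = false) ?mul0r //.
  by apply/eqP => -[e]; rewrite e eqxx in ne.
rewrite (@sum_only _ (emb b)); last first.
  move=> i ne; rewrite (_ : (_ == Some i) = false) ?mulr0 ?mul0r //.
  by apply/eqP => -[e]; rewrite e eqxx in ne.
rewrite !eqxx !mul1r mI_aut_wprod -/(mI _ a b) mI_aut_wprod; congr (_ * _).
by rewrite /trans /= weight_NN !run_clock !xpair_eqE !eqxx.
Qed.

Variable h : 'I_n -> CC.
Let q w := qf (fun i j : 'I_n => toC (wprod t Y w i j)) h.
(** In the notation of the overview, the sum over [m] of [kap m] times the form of [P_m] at [h]. It
    is linear in [kap], so the estimates reduce to identities between weights. *)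
Let Q (kap : nat -> CC) := \sum_(wc <- l) toC wc.2 * (kap (size wc.1) * q wc.1).

Let eqQ k1 k2 : k1 =1 k2 -> Q k1 = Q k2.
Proof. by move=> e; apply: eq_bigr => wc _; rewrite e. Qed.
Let QD k1 k2 : Q (fun m => k1 m + k2 m) = Q k1 + Q k2.
Proof. by rewrite /Q -big_split; apply: eq_bigr => wc _ /=; ring. Qed.
Let QZ c k1 : Q (fun m => c * k1 m) = c * Q k1.
Proof. by rewrite /Q mulr_sumr; apply: eq_bigr => wc _; ring. Qed.
Let Qsum r (c : nat -> CC) F :
  Q (fun m => \sum_(j < r) c j * F j m) = \sum_(j < r) c j * Q (F j).
Proof.
rewrite /Q; under [RHS]eq_bigr do rewrite mulr_sumr.
rewrite exchange_big /=; apply: eq_bigr => wc _.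
by rewrite mulr_suml mulr_sumr; apply: eq_bigr => j _; ring.
Qed.

Let q_ge0 w : is_word d w -> 0 <= q w.
Proof. by move=> hw; have /psdP := psd_wprod g u hY hw; apply. Qed.

Definition degree_part j := \sum_(w <- words d j) toC (coef d f w) * q w.

Lemma degree_part_ge0 j : 0 <= degree_part j.
Proof.
rewrite /degree_part big_seq; apply: sumr_ge0 => w; rewrite mem_words => /andP[hw _].
by rewrite mulr_ge0 ?coef_ge0 // q_ge0 //; apply/is_wordP.
Qed.

Lemma Q_base : qf (fun i j : 'I_n => toC (f t Y i j)) h = Q (fun _ => 1).
Proof.
have /meqP E : meq n n (f t Y) (lincomb t Y l).
  apply: (@start_lincomb Y (start kB) (start kB)); first exact: inCd_base.
  by move=> w i j; rewrite /start weight_BB mulr1.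
rewrite (eq_qf (y' := fun i j : 'I_n => \sum_(wc <- l) toC wc.2 * toC (wprod t Y wc.1 i j)) (x' := h)) //.
  by rewrite qf_sum; apply: eq_bigr => wc _; rewrite mul1r.
by move=> i j; rewrite E toC_lincomb.
Qed.

Lemma Q_scale : qf (fun i j : 'I_n => toC (f t tY i j)) h = Q (fun m => T ^+ m).
Proof.
have /meqP E : meq n n (f t tY) (lincomb t tY l).
  apply: (@start_lincomb tY (start kC) (start kC)); first exact: inCd_scale.
  by move=> w i j; rewrite wprod_scale /start weight_CC mulrC.
rewrite (eq_qf (y' := fun i j : 'I_n => \sum_(wc <- l) (toC wc.2 * T ^+ size wc.1) *
   toC (wprod t Y wc.1 i j)) (x' := h)) //.
  by rewrite qf_sum; apply: eq_bigr => wc _; rewrite mulrA.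
move=> i j; rewrite E toC_lincomb; apply: eq_bigr => wc _.
by rewrite wprod_scale mulrA.
Qed.

Let nil_index (a : 'I_n) (j : 'I_M.+1) : aut_index n 'I_M.+1 := (a, (ord0 : 'I_M.+1, j)).

(** Going from time 0 to time [j] isolates degree [j]. For [j = M], where the clock stops, longer
    words are excluded by their weight. *)
Lemma nil_entry w (a b : 'I_n) (j : 'I_M.+1) :
  mI (wprod Ns N w) (nil_index a j) (nil_index b j) =
  (size w == j)%:R * toC (wprod t Y w a b).
Proof.
rewrite mI_aut_wprod mulrC; congr (_ * _); rewrite /trans /= -natrM mulnb andbb.
rewrite weight_nil -natrM mulnb subn0; congr (nat_of_bool _)%:R.
rewrite -val_eqE /= run_nil add0n; have := ltn_ord j; lia.
Qed.

(** The nilpotent tuple has two expansions, by [l] and by [coef]; their entries ending at time [j]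
    identify the degree [j] part of [l] at [Y]. *)
Lemma Q_degree j : (j <= M)%N -> Q (fun m => (m == j)%:R) = degree_part j.
Proof.
move=> hj; have hj' : (j < M.+1)%N by [].
(* Words of length [M] survive, so nilpotency starts at [M.+1]. *)
have hnil w : is_word d w -> (M.+1 <= size w)%N -> meq (gn Ns) (gm Ns) (wprod Ns N w) mzero.
  move=> _ hw; apply/meqP => a b; case: (ord_rank a) (ord_rank b) => [a' ->] [b' ->].
  rewrite -/(mI _ a' b') mI_aut_wprod /trans.
  suff -> : weight (@nilS M) (@nilW M) w a'.2.1 b'.2.1 = 0 by rewrite mul0r mulr0.
  have W0 : forall w' (e e' : 'I_M.+1), (M - e < size w')%N -> weight (@nilS M) (@nilW M) w' e e' = 0.
    elim=> [|i w' IH] e e' //= hs; rewrite /nilW.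
    have [he|he] := ltnP e M; last by rewrite mul0r.
    by rewrite IH ?mulr0 // /nilS val_tick; lia.
  by apply: W0; apply: leq_ltn_trans hw; apply: leq_subr.
have E (a b : 'I_n) : \sum_(wc <- l) (toC wc.2 * (size wc.1 == j)%:R) * toC (wprod t Y wc.1 a b) =
   \sum_(w <- words d j) toC (coef d f w) * toC (wprod t Y w a b).
  pose a' := nil_index a (Ordinal hj').
  pose b' := nil_index b (Ordinal hj').
  have /meqP /(_ (enum_rank a') (enum_rank b')) := nil_lincomb.
  rewrite toC_lincomb (nilpotent_coef hf inCd_nil hnil) => E.
  transitivity (\sum_(wc <- l) toC wc.2 * mI (wprod Ns N wc.1) a' b').
    by apply: eq_bigr => wc _; rewrite nil_entry mulrA.
  rewrite -[LHS]E (@sum_only _ (Ordinal hj')) /=.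
    rewrite big_seq [RHS]big_seq; apply: eq_bigr => w; rewrite mem_words => /andP[_ hw].
    by rewrite -/(mI _ a' b') nil_entry /= hw mul1r.
  move=> k /eqP ne; rewrite big_seq big1 // => w; rewrite mem_words => /andP[_ /eqP hw].
  rewrite -/(mI _ a' b') nil_entry /= hw.
  have [e|_] := eqVneq (k : nat) j; last by rewrite mul0r mulr0.
  by case: ne; apply: val_inj.
transitivity (qf (fun a b : 'I_n => \sum_(wc <- l) (toC wc.2 * (size wc.1 == j)%:R) *
    toC (wprod t Y wc.1 a b)) h).
  by rewrite qf_sum; apply: eq_bigr => wc _; rewrite mulrA.
rewrite (eq_qf (y' := fun a b : 'I_n => \sum_(w <- words d j) toC (coef d f w) *
   toC (wprod t Y w a b)) (x' := h)) //.
by rewrite qf_sum.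
Qed.

(** Positivity of [f Z] at [h] tensored with the difference of the start states [x] and [y],
    constant in the end state. *)
Lemma Q_difference (x y : clock_state M) :
  0 <= \sum_(wc <- l) toC wc.2 *
    ((wt wc.1 x x - wt wc.1 x y - wt wc.1 y x + wt wc.1 y y) * q wc.1).
Proof.
have /psd_mI hZ := hpos inCd_clock (pos_pres_sym _ _ _) (fun i hi => psd_Z (introT ssrnat.ltP hi)).
pose lam (e : clock_state M) : CC := (e == x)%:R + -1 * (e == y)%:R.
have := hZ (fun a : aut_index n (clock_state M) => h a.1 * lam a.2.1).
rewrite (eq_qf (y' := fun a b => \sum_(wc <- l) toC wc.2 * mI (wprod Zs Z wc.1) a b)
  (x' := fun a : aut_index n (clock_state M) => h a.1 * lam a.2.1)) //; last first.
  by move=> a b; have /meqP /(_ (enum_rank a) (enum_rank b)) := El; rewrite toC_lincomb.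
rewrite qf_sum; congr (0 <= _); apply: eq_bigr => wc _; congr (_ * _).
rewrite qf_aut qf_two rmorphN rmorph1 -/(q _) -/wt; ring.
Qed.

(** For [kB] and [kN] the four weights are 1 and three copies of the indicator of [m <= M], two of
    them with a minus sign. *)
Lemma Q_tail_ge0 : 0 <= Q (fun m => 1 - (m <= M)%N%:R).
Proof.
have := Q_difference (start kB) (start kN); congr (0 <= _); apply: eq_bigr => wc _.
rewrite /wt /start weight_BB weight_BN weight_NB weight_NN weight_nil subn0.
by congr (_ * (_ * _)); ring.
Qed.

(** For [kA] and [kB] both cross weights are 1, which leaves [T ^+ (m - M) - 1 - 1 + 1]. *)
Lemma Q_power_ge0 : 0 <= Q (fun m => T ^+ (m - M) - 1).
Proof.
have := Q_difference (start kA) (start kB); congr (0 <= _); apply: eq_bigr => wc _.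
rewrite /wt /start weight_BB weight_AB weight_BA weight_AA subn0.
by congr (_ * (_ * _)); ring.
Qed.

Lemma remainder_bound_lincomb :
  let E := qf (fun i j : 'I_n => toC (f t Y i j)) h - \sum_(j < M.+1) degree_part j in
  0 <= E /\ T ^+ M * E <= qf (fun i j : 'I_n => toC (f t tY i j)) h.
Proof.
have D (m : nat) : \sum_(j < M.+1) 1 * (m == j)%:R = (m <= M)%N%:R :> CC.
  have [hm|hm] := leqP m M.
    rewrite (@sum_only _ (Ordinal (hm : (m < M.+1)%N))); first by rewrite /= eqxx mul1r.
    move=> j /eqP ne; have [e|_] := eqVneq m j; last by rewrite mulr0.
    by case: ne; apply: val_inj.
  rewrite big1 // => j _; have [e|_] := eqVneq m j; last by rewrite mulr0.
  by have := ltn_ord j; rewrite -e ltnS leqNgt hm.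
have DT (m : nat) : \sum_(j < M.+1) T ^+ j * (m == j)%:R = T ^+ m * (m <= M)%N%:R.
  rewrite -D mulr_sumr; apply: eq_bigr => j _.
  by have [->|_] := eqVneq m j; rewrite ?mul1r ?mulr0.
have S1 : \sum_(j < M.+1) degree_part j = Q (fun m => (m <= M)%N%:R).
  rewrite -(eqQ D) (Qsum (fun=> 1) (fun j m => (m == j)%:R)); apply: eq_bigr => j _.
  by rewrite mul1r Q_degree // -ltnS.
have EE : qf (fun i j : 'I_n => toC (f t Y i j)) h - \sum_(j < M.+1) degree_part j =
    Q (fun m => 1 - (m <= M)%N%:R).
  rewrite Q_base S1 -[- Q _]mulN1r -QZ -QD; apply: eqQ => m; ring.
move=> E; rewrite /E EE; split; first exact: Q_tail_ge0.
rewrite Q_scale -QZ -subr_ge0 -[- Q _]mulN1r -QZ -QD.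
(* The weight [T^m - T^M [m > M]] splits into the degrees up to [M], whose parts are nonnegative by
   [degree_part_ge0], and [T^M] times the weight of [Q_power_ge0]. *)
rewrite (@eqQ _ (fun m => \sum_(j < M.+1) T ^+ j * (m == j)%:R + T ^+ M * (T ^+ (m - M) - 1))).
  rewrite QD (Qsum (fun j => T ^+ j) (fun j m => (m == j)%:R)) QZ; apply: addr_ge0; last by rewrite mulr_ge0 ?exprn_ge0 ?Q_power_ge0.
  apply: sumr_ge0 => j _; rewrite Q_degree -1?ltnS //.
  by rewrite mulr_ge0 ?exprn_ge0 ?degree_part_ge0.
move=> m; rewrite DT; have [hm|hm] := leqP m M.
  by rewrite (eqP (hm : (m - M)%N == 0%N)) expr0 /=; ring.
by rewrite -{1}(subnKC (ltnW hm)) exprD /=; ring.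
Qed.

End Expansion.

Lemma remainder_bound h :
  let E := qf (fun i j : 'I_n => toC (f t Y i j)) h -
     \sum_(j < M.+1) \sum_(w <- words d j)
        toC (coef d f w) * qf (fun i j : 'I_n => toC (wprod t Y w i j)) h in
  0 <= E /\ T ^+ M * E <= qf (fun i j : 'I_n => toC (f t tY i j)) h.
Proof.
have [l [hl El]] := proj1 hf _ _ inCd_clock.
exact: (remainder_bound_lincomb hl El h).
Qed.

End Remainder.

(** * Convergence *)

Section Polarization.
Variable C : numClosedFieldType.

Definition two_vec (I : finType) (p q : I) (c : C) (k : I) : C :=
  (k == p)%:R + c * (k == q)%:R.

Lemma polarization_bound (I : finType) (y : I -> I -> C) (p q : I) (v := two_vec p q) :
  `|y p q| <= `|qf y (v 1)| + `|qf y (v (-1))| + `|qf y (v 'i)| + `|qf y (v (- 'i))|.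
Proof.
have i2 : 'i * 'i = -1 :> C by rewrite -expr2 sqrCi.
(* Polarization; the factor 4 is afterwards given away. *)
have E : 4 * y p q = qf y (v 1) - qf y (v (-1)) - 'i * qf y (v 'i) + 'i * qf y (v (- 'i)).
  rewrite /v /two_vec !qf_two !rmorphN /= conjC1 conjCi.
  have -> : forall a b c e : C, a + 1 * b + 1 * c + 1 * 1 * e - (a + -1 * b + -1 * c + -1 * -1 * e)
     - 'i * (a + 'i * b + - 'i * c + - 'i * 'i * e)
     + 'i * (a + - 'i * b + - - 'i * c + - - 'i * - 'i * e) =
     2 * b + 2 * c - 2 * ('i * 'i) * b + 2 * ('i * 'i) * c by move=> a b c e; ring.
  by rewrite i2; ring.
apply: (@le_trans _ _ `|4 * y p q|).
  by rewrite normrM normr_nat ler_peMl // ler1n.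
have ni : `|'i| = 1 :> C by apply: normCi.
rewrite E; apply: le_trans (ler_normD _ _) _; rewrite normrM ni mul1r lerD2r.
apply: le_trans (ler_normB _ _) _; rewrite normrM ni mul1r lerD2r.
exact: ler_normB.
Qed.

End Polarization.

Lemma Ccv_geometric (v : nat -> Cplx) (z : Cplx) (T B : CC) : 1 < T ->
  (forall M, T ^+ M * `|toC z - toC (v M)| <= B) -> Ccv v z.
Proof.
move=> T1 h; have T0 : 0 < T := lt_trans ltr01 T1.
have B0 : 0 <= B by apply: le_trans (h 0%N); rewrite expr0 mul1r.
have TE := rCE (ltW T0); have BE := rCE B0.
set T' := Cre _ in TE; set B' := Cre _ in BE.
have T1' : Rlt R1 T' by apply/rC_lt; rewrite -TE.
have key e : Rlt R0 e -> exists N, forall M, (N <= M)%coq_nat -> Rlt (Cabs (Csub z (v M))) e.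
  (* Eventually [T' ^ M] is at least [B' / e + 1]; the 1 makes the resulting inequality strict. *)
  move=> e0; have [N HN] := pow_dominates (Rplus (Rdiv B' e) R1) R1 T' (conj Rle_0_1 T1').
  exists N => M hM; have := HN M hM; rewrite pow1 Rmult_1_r => hp.
  have hb : Rle (Rmult (pow T' M) (Cabs (Csub z (v M)))) B'.
    apply/rC_le; rewrite rCM rCX -TE -BE -norm_toC.
    have -> : toC (Csub z (v M)) = toC z - toC (v M) by [].
    exact: h.
  have pT : Rlt R0 (pow T' M) by apply: pow_lt; Lra.lra.
  have hBe : Rmult (Rdiv B' e) e = B' by rewrite /Rdiv Rmult_assoc Rinv_l ?Rmult_1_r //; Lra.lra.
  apply: (Rmult_lt_reg_l (pow T' M)) => //; apply: (Rle_lt_trans _ _ _ hb).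
  have := Rmult_le_compat_r e _ _ (Rlt_le _ _ e0) hp; Lra.lra.
have cabs x : Rle (Rabs (Cre x)) (Cabs x) /\ Rle (Rabs (Cim x)) (Cabs x).
  case: x => a b; rewrite /Cabs /=.
  have sq r : Rle R0 (Rmult r r) by exact: Rle_0_sqr.
  by split; rewrite -sqrt_Rsqr_abs /Rsqr; apply: sqrt_le_1_alt;
    have := sq a; have := sq b; Lra.lra.
split=> e e0; have [N HN] := key e e0; exists N => M hM; rewrite /R_dist Rabs_minus_sym.
  exact: Rle_lt_trans (proj1 (cabs (Csub z (v M)))) (HN M hM).
exact: Rle_lt_trans (proj2 (cabs (Csub z (v M)))) (HN M hM).
Qed.

Section SymmetricCase.
Variables (d : nat) (f : GSP -> (nat -> Mat) -> Mat).
Hypothesis hf : nc_function d f.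
Hypothesis hpos : nc_pos_pres d f.

Lemma sym_convergence n g u Y : is_ualg n g u -> (forall i, (i < d)%N -> psd n (Y i)) ->
  geo d (sym n g u) Y -> forall p q : 'I_n,
  Ccv (fun K => psum d (coef d f) (sym n g u) Y K p q) (f (sym n g u) Y p q).
Proof.
move=> hu hY [K [rho [K0 rho0 rho1 gY]]] p q; set t := sym n g u.
(* As [rho < 1], both [T > 1] and [T * rho = 2 rho / (1 + rho) < 1] hold. *)
pose T : CC := 2 / (1 + rho).
have r0 : 0 < 1 + rho by rewrite ltr_wpDr.
have T1 : 1 < T by rewrite ltr_pdivlMr // mul1r -[2]/(1 + 1) ltrD2l.
have Trho : T * rho < 1.
  by rewrite mulrAC ltr_pdivrMr // mul1r mulr2n mulrDl mul1r ltrD2r.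
pose E M (i j : 'I_n) := toC (f t Y i j) - toC (psum d (coef d f) t Y M i j).
(* The form of [f (T Y)] bounds [T ^+ M] times the remainder and does not depend on [M]. *)
pose bnd h := qf (fun i j : 'I_n => toC (f t (fun i => mscale (ofC T) (Y i)) i j)) h.
have EB M h : `|T ^+ M * qf (E M) h| <= bnd h.
  have [h0 h1] := remainder_bound hf hpos hu hY K0 rho0 gY (ltW T1) Trho M h.
  have -> : qf (E M) h = qf (fun i j : 'I_n => toC (f t Y i j)) h -
     \sum_(j < M.+1) \sum_(w <- words d j)
        toC (coef d f w) * qf (fun i j : 'I_n => toC (wprod t Y w i j)) h.
    rewrite qf_sub; congr (_ - _).
    rewrite (eq_qf (y' := fun i j : 'I_n => \sum_(k < M.+1) 1 * \sum_(w <- words d k)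
       toC (coef d f w) * toC (wprod t Y w i j)) (x' := h)) //.
      by rewrite qf_sum; apply: eq_bigr => k _; rewrite mul1r qf_sum.
    by move=> i j; rewrite toC_psum; apply: eq_bigr => k _; rewrite mul1r.
  by rewrite ger0_norm // mulr_ge0 // exprn_ge0 // ltW // (lt_trans ltr01).
pose v := @two_vec CC _ p q.
apply: (Ccv_geometric T1 (B := bnd (v 1) + bnd (v (-1)) + bnd (v 'i) + bnd (v (- 'i)))) => M.
have TM : 0 <= T ^+ M by rewrite exprn_ge0 // ltW // (lt_trans ltr01).
apply: le_trans (_ : _ <= T ^+ M * (`|qf (E M) (v 1)| + `|qf (E M) (v (-1))| +
   `|qf (E M) (v 'i)| + `|qf (E M) (v (- 'i))|)) _.
  by apply: ler_wpM2l => //; apply: (polarization_bound (E M) p q).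
rewrite !mulrDr; have N h : T ^+ M * `|qf (E M) h| <= bnd h.
  by rewrite -{1}(ger0_norm TM) -normrM.
by do 3!apply: lerD => //.
Qed.

Lemma nc_power_series : exists c : list nat -> Cplx,
    (forall alpha, Cim (c alpha) = R0 /\ Rle R0 (Cre (c alpha))) /\
    (forall s X, inCd d s X ->
       forall p q, (p < gn s)%coq_nat -> (q < gm s)%coq_nat ->
         Ccv (fun K => psum d c s X K p q) (f s X p q)).
Proof.
exists (coef d f); split; first by move=> w; apply/toC_ge0/coef_ge0.
(* An arbitrary contraction is the lower-left corner of a tuple [Y] covered by the symmetric case;
   [f] and the partial sums both pass to the corner, whose entry [(p, q)] sits at
   [(gm s + p, q)]. *)
move=> s X hX p q /ssrnat.ltP hp /ssrnat.ltP hq; have [Y [hY gY hw]] := inCd_block hX.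
have hu : is_ualg (gm s + gn s) _ _ := proj1 (is_gsp_block (proj1 hX)).
have hYC : inCd d (block_gsp s) Y by apply: inCd_sym.
have hP : (gm s + p < gm s + gn s)%N by rewrite ltn_add2l.
have hQ : (q < gm s + gn s)%N by apply: leq_trans hq _; apply: leq_addr.
have /meqP /(_ (Ordinal hp) (Ordinal hq)) /= /toC_inj -> := nc_block hf hX hYC hw.
have [h1 h2] := sym_convergence hu hY gY (Ordinal hP) (Ordinal hQ).
have E K : psum d (coef d f) s X K p q =
    psum d (coef d f) (block_gsp s) Y K (gm s + p)%N q.
  apply: toC_inj; rewrite !toC_psum; apply: eq_bigr => k _.
  rewrite big_seq [RHS]big_seq; apply: eq_bigr => w; rewrite mem_words => /andP[hwb _].
  have hwd : is_word d w by apply/is_wordP.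
  by have /meqP /(_ (Ordinal hp) (Ordinal hq)) /= <- := hw w hwd.
split=> e e0; [have [N HN] := h1 e e0 | have [N HN] := h2 e e0];
  by exists N => M hM; have := HN M hM; cbv beta; rewrite E.
Qed.

End SymmetricCase.

End Schur.

Theorem mainTheorem5 (d : nat) (f : GSP -> (nat -> Mat) -> Mat) :
  nc_function d f -> nc_pos_pres d f ->
  exists c : list nat -> Cplx,
    (forall alpha, Cim (c alpha) = 0 /\ 0 <= Cre (c alpha)) /\
    (forall s X, inCd d s X ->
       forall p q, (p < gn s)%nat -> (q < gm s)%nat ->
         Ccv (fun K => psum d c s X K p q) (f s X p q)).
Proof.
exact (@Schur.nc_power_series d f).
Qed.
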